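(* Let $m>1$, $0<\kappa\le1$ and $\gamma\in\Gamma(\kappa)$. If $s>\max\left\{\frac14,\frac{1-m\kappa}{2}\right\}$, then there exists a constant $C$ such that $$\left(\int_{-1}^1\sup_{t\in[-1,1]}|S_tf(\gamma(x,t))|^2\,dx\right)^{\frac12}\le C\|f\|_{H^s}$$ holds for all $f\in H^s(\mathbb R)$.
   Context: For $0<\kappa\le1$, $\Gamma(\kappa)$ is the collection of continuous functions $\gamma:\mathbb R\times[-1,1]\to\mathbb R$ with $\gamma(x,0)=x$ for which there are constants $C_1,C_2>0$ such that $|\gamma(x,t)-\gamma(x,t')|\le C_1|t-t'|^\kappa$ for all $x\in\mathbb R$, $t,t'\in[-1,1]$, and $\frac1{C_2}|x-x'|\le|\gamma(x,t)-\gamma(x',t)|\le C_2|x-x'|$ for all $t\in[-1,1]$, $x,x'\in\mathbb R$. $H^s(\mathbb R)$ is the Sobolev space of order $s$ with norm $\|f\|_{H^s}=\|(1-\Delta)^{s/2}f\|_{L^2(\mathbb R)}$, and $\widehat f(\xi)=\int_{\mathbb R}e^{-ix\xi}f(x)\,dx$. The evolution operator $S_t$ (giving the formal solution of the fractional Schrödinger equation $i\partial_tu+(-\Delta)^{m/2}u=0$ with $u(\cdot,0)=f$) is defined on appropriate input functions by $$S_tf(x)=\frac1{2\pi}\int_{\mathbb R}e^{i(x\xi+t|\xi|^m)}\widehat f(\xi)\,d\xi .$$ *)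

(* Defs.v *)
From mathcomp Require Import all_boot all_order all_algebra complex.
From mathcomp Require Import all_classical all_reals all_analysis.

Set Implicit Arguments.
Unset Strict Implicit.
Unset Printing Implicit Defensive.

Import Order.TTheory GRing.Theory Num.Theory.
Import numFieldNormedType.Exports.

Local Open Scope classical_set_scope.
Local Open Scope ring_scope.
Local Open Scope complex_scope.

Section Complex_valued_functions.
Context {R : realType}.
Local Notation mu := (@lebesgue_measure R).

Definition cexp (theta : R) : R[i] := cos theta +i* sin theta.

(* Componentwise Lebesgue integral; Rintegral is 0 on a component whose
   integral is infinite or undefined. *)
Definition Cintegral (D : set R) (f : R -> R[i]) : R[i] :=
  (\int[mu]_(x in D) complex.Re (f x)) +i* (\int[mu]_(x in D) complex.Im (f x)).

Definition Cmeasurable (f : R -> R[i]) : Prop :=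
  measurable_fun setT (fun x => complex.Re (f x)) /\
  measurable_fun setT (fun x => complex.Im (f x)).

Definition L2norm (f : R -> R[i]) : \bar R :=
  Lnorm mu 2%:E (fun x => (Normc.normc (f x))%:E).

Definition isL2 (f : R -> R[i]) : Prop :=
  Cmeasurable f /\ (L2norm f < +oo)%E.

Definition fourier_trunc (N : nat) (f : R -> R[i]) (xi : R) : R[i] :=
  Cintegral `[- N%:R, N%:R] (fun x => cexp (- (x * xi)) * f x).

(* The L^2 (Plancherel) Fourier transform: the integral defining it is the limit
   in L^2 of its truncations, since f need not be integrable. *)
Definition is_fourier (f g : R -> R[i]) : Prop :=
  [/\ isL2 f, isL2 g &
      L2norm (fun xi => g xi - fourier_trunc N f xi) @[N --> \oo] --> 0%E].

(* By Plancherel's theorem every f in L^2 has a transform, unique up to equality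
   almost everywhere; xget selects a representative. *)
Definition fourier (f : R -> R[i]) : R -> R[i] :=
  xget (fun=> 0) [set g | is_fourier f g].

(* h = (1 - Delta)^(s/2) f, that is, hat h (xi) = (1 + xi^2)^(s/2) hat f (xi). *)
Definition is_bessel (s : R) (f h : R -> R[i]) : Prop :=
  is_fourier h (fun xi => ((1 + xi ^+ 2) `^ (s / 2))%:C * fourier f xi).

Definition bessel (s : R) (f : R -> R[i]) : R -> R[i] :=
  xget (fun=> 0) [set h | is_bessel s f h].

(* Membership in H^s(R). Only meant for s >= 0, where H^s is contained in L^2
   and distributions are not needed. *)
Definition sobolev (s : R) (f : R -> R[i]) : Prop :=
  isL2 f /\ exists h, is_bessel s f h.

Definition sobolev_norm (s : R) (f : R -> R[i]) : \bar R :=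
  L2norm (bessel s f).

Definition evol_trunc (m t : R) (f : R -> R[i]) (x : R) (N : nat) : R[i]^o :=
  ((2 * pi)^-1)%:C *
  Cintegral `[- N%:R, N%:R]
    (fun xi => cexp (x * xi + t * `|xi| `^ m) * fourier f xi).

(* The integral defining S_t f (x) is read as the limit of its symmetric
   truncations, since hat f need not be integrable for f in H^s with s <= 1/2.
   If hat f is integrable, this is the Lebesgue integral over R. *)
Definition evol_defined (m t : R) (f : R -> R[i]) (x : R) : Prop :=
  cvgn (evol_trunc m t f x).

(* When the limit does not exist, limn returns a junk value. *)
Definition evol (m t : R) (f : R -> R[i]) (x : R) : R[i] :=
  limn (evol_trunc m t f x).

End Complex_valued_functions.

(* gamma is a function on R * R, but only its restriction to R * [-1, 1] is
   constrained. *)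
Definition Gamma_class {R : realType} (kappa : R) (gamma : R -> R -> R) : Prop :=
  [/\ {within [set z : R * R | z.2 \in `[-1, 1]],
         continuous (fun z : R * R => gamma z.1 z.2)},
      forall x, gamma x 0 = x &
      exists C1 C2 : R,
        [/\ 0 < C1, 0 < C2,
            forall x t t', t \in `[-1, 1] -> t' \in `[-1, 1] ->
              `|gamma x t - gamma x t'| <= C1 * `|t - t'| `^ kappa &
            forall t x x', t \in `[-1, 1] ->
              C2^-1 * `|x - x'| <= `|gamma x t - gamma x' t| <= C2 * `|x - x'|]].

(* Main.v *)
(** The frequency line is cut into dyadic annuli $\lambda < |\xi| \le 2\lambda$. On each of them the
    maximal operator over [t] and over the truncation [N] is bounded on $L^2$ of $[-1, 1]$ with
    constant $C \lambda^{2\sigma}$ for some $\sigma < s$, by $T T^*$: van der Corput's lemma gives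
    kernels $O(\lambda^{2\sigma} |x - y|^{-\alpha})$ with $\alpha < 1$, whatever the times and
    truncations chosen at $x$ and $y$. No measurable choice of these is needed, because the
    supremum is Lipschitz in $x$ and its integral is a limit of Riemann sums, to which Bessel's
    inequality for almost orthogonal vectors applies.

    Since $\sigma < s$, the majorants $\Phi_k$ of the annuli $\lambda = 2^k$ sum with weights
    $2^{2k(s - \sigma)}$ to an integrable function $H$. Where $H$ is finite the truncations are Cauchy,
    with a limit bounded by a multiple of $H^{1/2}$; where $H$ is infinite the bound is void.

    Only the inequality $\|\hat h\|_2 \le C \|h\|_2$ of Plancherel's theorem is used. It comes from the
    orthogonality on $[-N, N]$ of exponentials with frequencies spaced by $\pi / N$. *)

Require Import Defs.
From mathcomp Require Import all_boot all_order all_algebra complex.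
From mathcomp Require Import all_classical all_reals all_analysis.
From mathcomp Require Import measurable_realfun ring lra.
Set Implicit Arguments.
Unset Strict Implicit.
Unset Printing Implicit Defensive.
Import Order.TTheory GRing.Theory Num.Theory.
Import numFieldNormedType.Exports.
Local Open Scope classical_set_scope.
Local Open Scope ring_scope.

(** The two thresholds for $s$ come from two ways for the kernel to decay. Put $a = \gamma(x,t) -
    \gamma(y,t')$, $b = t - t'$, $D = |x - y|$. If $|a| \gtrsim D$, the kernel is $O((\lambda /
    D)^{1/2})$ whatever $b$ is, which asks for $2\sigma \ge 1/2$. Otherwise $|b| \gtrsim
    D^{1/\kappa}$, and the decay in $b$ gives $O(\lambda^{1 - m/2} D^{-1/(2\kappa)})$. For $\kappa
    \le 1/2$ this singularity is not integrable, so only a power $\theta < 2\kappa$ of the bound is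
    kept, the remaining power $1 - \theta$ being spent on the trivial bound $\lambda$; as $\theta
    \to 2\kappa$ the exponent $1 - \theta m / 2$ of $\lambda$ tends to $1 - m\kappa$.

    A complex function is carried as a pair $(u, v)$ of real ones, and an oscillatory integral by
    its real part; the imaginary part is the real part for $(v, -u)$.

    The truncation $N$ is a parameter on the same footing as $t$. The bound on the supremum
    therefore also gives the existence of the limit that defines $S_t f$, for all $t$ at once
    outside a single null set. *)

(** * Real pairings in $L^2$ and Bessel's inequality under almost orthogonality *)

Section Square_integrable.
Context {d : measure_display} {T : measurableType d} {R : realType}
  {mu : {measure set T -> \bar R}} {D : set T} (mD : measurable D).
Implicit Types f g u v : T -> R.

Definition square_integrable (D : set T) f :=
  measurable_fun D f /\ mu.-integrable D (EFin \o (fun x => f x ^+ 2)).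

Lemma integrable_EFinD f g :
  mu.-integrable D (EFin \o f) -> mu.-integrable D (EFin \o g) ->
  mu.-integrable D (EFin \o (fun x => f x + g x)).
Proof. exact: integrableD. Qed.

Lemma integrable_EFinB f g :
  mu.-integrable D (EFin \o f) -> mu.-integrable D (EFin \o g) ->
  mu.-integrable D (EFin \o (fun x => f x - g x)).
Proof. exact: integrableB. Qed.

Lemma integrable_EFinZ a f :
  mu.-integrable D (EFin \o f) -> mu.-integrable D (EFin \o (fun x => a * f x)).
Proof. exact: integrableZl. Qed.

Lemma le_sq_integrable f g : measurable_fun D f ->
  mu.-integrable D (EFin \o g) -> (forall x, D x -> `|f x| <= g x) ->
  mu.-integrable D (EFin \o f).
Proof.
move=> mf ig fg; apply: (le_integrable mD _ _ ig).
  exact/measurable_EFinP.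
by move=> x Dx; rewrite /= lee_fin (le_trans (fg x Dx))// ler_norm.
Qed.

Lemma square_integrable_mul f g :
  square_integrable D f -> square_integrable D g ->
  mu.-integrable D (EFin \o (fun x => f x * g x)).
Proof.
move=> [mf f2] [mg g2].
apply: (@le_sq_integrable _ (fun x => f x ^+ 2 + g x ^+ 2)).
- exact: measurable_funM.
- exact: integrable_EFinD.
- move=> x _; rewrite ler_norml.
  have := sqr_ge0 (f x - g x); have := sqr_ge0 (f x + g x).
  by move=> h1 h2; apply/andP; split; nra.
Qed.

Lemma square_integrableZ a f :
  square_integrable D f -> square_integrable D (fun x => a * f x).
Proof.
move=> [mf f2]; split; first exact: measurable_funM.
under [X in _ \o X]eq_fun do rewrite exprMn.
exact: integrable_EFinZ.
Qed.

Lemma square_integrableD f g :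
  square_integrable D f -> square_integrable D g ->
  square_integrable D (fun x => f x + g x).
Proof.
move=> [mf f2] [mg g2]; split; first exact: measurable_funD.
apply: (@le_sq_integrable _ (fun x => 2 * (f x ^+ 2 + g x ^+ 2))).
- by apply: measurable_funX; exact: measurable_funD.
- by apply: integrable_EFinZ; exact: integrable_EFinD.
- move=> x _; rewrite ger0_norm ?sqr_ge0//.
  by have := sqr_ge0 (f x - g x); nra.
Qed.

Lemma square_integrableB f g :
  square_integrable D f -> square_integrable D g ->
  square_integrable D (fun x => f x - g x).
Proof.
move=> sf sg; rewrite (_ : (fun _ => _) = fun x => f x + (-1) * g x).
  by apply: square_integrableD => //; exact: square_integrableZ.
by apply/funext => x; rewrite mulN1r.
Qed.

Lemma square_integrable_sum (I : Type) (s : seq I) (F : I -> T -> R) :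
  (forall i, square_integrable D (F i)) ->
  square_integrable D (fun x => \sum_(i <- s) F i x).
Proof.
move=> sF; elim: s => [|i s ih].
  split; first by under eq_fun do rewrite big_nil; exact: measurable_cst.
  under [X in _ \o X]eq_fun do rewrite big_nil expr0n/=.
  exact: integrable0.
by under eq_fun do rewrite big_cons; exact: square_integrableD.
Qed.

Lemma bounded_square_integrable f M : (mu D < +oo)%E -> measurable_fun D f ->
  (forall x, D x -> `|f x| <= M) -> square_integrable D f.
Proof.
move=> Doo mf fM; split => //.
apply: (@le_sq_integrable _ (cst (M ^+ 2))).
- exact: measurable_funX.
- apply/integrableP; split; first exact/measurable_EFinP/measurable_cst.
  rewrite /= integral_cst// lte_mul_pinfty//.
- move=> x Dx; rewrite normrX lerXn2r ?nnegrE//; last exact: fM.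
  by rewrite (le_trans _ (fM _ Dx)).
Qed.

Lemma Rintegral_sum (I : Type) (s : seq I) (F : I -> T -> R) :
  (forall i, mu.-integrable D (EFin \o F i)) ->
  mu.-integrable D (EFin \o (fun x => \sum_(i <- s) F i x)) /\
  (\int[mu]_(x in D) \sum_(i <- s) F i x = \sum_(i <- s) \int[mu]_(x in D) F i x)%R.
Proof.
move=> iF; elim: s => [|i s [ih1 ih2]].
  split; first by under [X in _ \o X]eq_fun do rewrite big_nil; exact: integrable0.
  rewrite big_nil; under eq_Rintegral do rewrite big_nil.
  by rewrite Rintegral_cst// mul0r.
split.
  under [X in _ \o X]eq_fun do rewrite big_cons.
  exact: integrable_EFinD.
rewrite big_cons -ih2 -RintegralD//.
by apply: eq_Rintegral => x _; rewrite big_cons.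
Qed.

(** The real part of $\langle u + i v, p + i q\rangle$ in $L^2(D)$, so that the Hilbert space
    arguments take place over the reals. *)
Definition pairing D (u v p q : T -> R) : R :=
  (\int[mu]_(x in D) (u x * p x + v x * q x))%R.

Lemma pairing_integrable u v p q :
  square_integrable D u -> square_integrable D v ->
  square_integrable D p -> square_integrable D q ->
  mu.-integrable D (EFin \o (fun x => u x * p x + v x * q x)).
Proof.
move=> su sv sp sq.
by apply: integrable_EFinD; exact: square_integrable_mul.
Qed.

Lemma pairing_sumr (n : nat) (c : 'I_n -> R) (p q : 'I_n -> T -> R) u v :
  square_integrable D u -> square_integrable D v ->
  (forall j, square_integrable D (p j)) -> (forall j, square_integrable D (q j)) ->
  pairing D u v (fun x => \sum_j c j * p j x) (fun x => \sum_j c j * q j x) =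
  \sum_j c j * pairing D u v (p j) (q j).
Proof.
move=> su sv sp sq; rewrite /pairing.
have iF j : mu.-integrable D (EFin \o (fun x => c j * (u x * p j x + v x * q j x))).
  by apply: integrable_EFinZ; exact: pairing_integrable.
transitivity (\sum_j \int[mu]_(x in D) (c j * (u x * p j x + v x * q j x)))%R.
  rewrite -(Rintegral_sum _ iF).2; apply: eq_Rintegral => x _.
  rewrite !mulr_sumr -big_split/=; apply: eq_bigr => j _; ring.
by apply: eq_bigr => j _; rewrite RintegralZl//; exact: pairing_integrable.
Qed.

Lemma pairingC u v p q : pairing D u v p q = pairing D p q u v.
Proof. by apply: eq_Rintegral => x _; rewrite mulrC (mulrC (v x)). Qed.

(* With $c_j = \langle u, p_j\rangle$ and $\tau = 1 / A$, expand
   $0 \le \|u - \tau \sum_j c_j p_j\|^2$ and bound the Gram form by the row sums. *)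
Lemma bessel_almost_orthogonal (n : nat) (p q : 'I_n -> T -> R) u v (A : R) :
  0 < A ->
  square_integrable D u -> square_integrable D v ->
  (forall j, square_integrable D (p j)) -> (forall j, square_integrable D (q j)) ->
  (forall j, \sum_k `|pairing D (p j) (q j) (p k) (q k)| <= A) ->
  \sum_j pairing D u v (p j) (q j) ^+ 2 <= A * pairing D u v u v.
Proof.
move=> A0 su sv sp sq rowA.
pose c j := pairing D u v (p j) (q j).
pose U x := \sum_j c j * p j x; pose V x := \sum_j c j * q j x.
have sU : square_integrable D U.
  by apply: square_integrable_sum => j; exact: square_integrableZ.
have sV : square_integrable D V.
  by apply: square_integrable_sum => j; exact: square_integrableZ.
pose t := A^-1.
have h0 : 0 <= pairing D (fun x => u x - t * U x) (fun x => v x - t * V x)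
                         (fun x => u x - t * U x) (fun x => v x - t * V x).
  by apply: Rintegral_ge0 => x _; rewrite -!expr2 addr_ge0 ?sqr_ge0.
have uU : pairing D u v U V = \sum_j c j ^+ 2.
  by rewrite pairing_sumr//; apply: eq_bigr => j _; rewrite expr2.
have UU : pairing D U V U V <= A * \sum_j c j ^+ 2.
  rewrite pairing_sumr//.
  under eq_bigr do rewrite pairingC pairing_sumr// mulr_sumr.
  (* Schur's test: $2 |c_j c_k| \le c_j^2 + c_k^2$ and the symmetry of the Gram matrix leave each
     $c_j^2$ multiplied by row sums only. *)
  have le1 : forall j k, c j * (c k * pairing D (p j) (q j) (p k) (q k)) <=
     (c j ^+ 2 * `|pairing D (p j) (q j) (p k) (q k)| +
      c k ^+ 2 * `|pairing D (p k) (q k) (p j) (q j)|) / 2.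
    move=> j k; rewrite (pairingC (p k)).
    set K := pairing _ _ _ _ _.
    have h1 := sqr_ge0 (c j - c k); have h2 := sqr_ge0 (c j + c k).
    have h3 := ler_norm K; have h4 := ler_norm (- K); rewrite normrN in h4.
    have ->: c j * (c k * K) = ((c j * c k) * K) by ring.
    have ->: (c j ^+ 2 * `|K| + c k ^+ 2 * `|K|) / 2 = (c j ^+ 2 + c k ^+ 2) / 2 * `|K| by lra.
    apply: le_trans (ler_norm _) _; rewrite normrM ler_wpM2r//.
    by rewrite ler_norml; apply/andP; split; nra.
  apply: (@le_trans _ _ (\sum_j \sum_k (c j ^+ 2 * `|pairing D (p j) (q j) (p k) (q k)| +
      c k ^+ 2 * `|pairing D (p k) (q k) (p j) (q j)|) / 2)).
    by apply: ler_sum => j _; apply: ler_sum => k _; exact: le1.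
  under eq_bigr do rewrite -mulr_suml big_split/=.
  rewrite -mulr_suml big_split/= [X in _ + X]exchange_big/=.
  set Z := \sum_j _.
  rewrite [X in X / 2](_ : _ = 2 * Z); last by rewrite /Z; ring.
  rewrite mulrC mulKf// /Z mulr_sumr; apply: ler_sum => j _.
  by rewrite -mulr_sumr mulrC ler_wpM2r ?sqr_ge0.
have E : pairing D (fun x => u x - t * U x) (fun x => v x - t * V x)
                   (fun x => u x - t * U x) (fun x => v x - t * V x) =
  pairing D u v u v - 2 * t * pairing D u v U V + t ^+ 2 * pairing D U V U V.
  rewrite /pairing -!RintegralZl//; try exact: pairing_integrable.
  rewrite -RintegralB//; [|exact: pairing_integrable|]; last first.
    by apply: integrable_EFinZ; exact: pairing_integrable.
  rewrite -RintegralD//.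
  - by apply: eq_Rintegral => x _; ring.
  - apply: integrable_EFinB; first exact: pairing_integrable.
    by apply: integrable_EFinZ; exact: pairing_integrable.
  - by apply: integrable_EFinZ; exact: pairing_integrable.
rewrite {}E uU in h0.
set S := \sum_j c j ^+ 2 in uU UU h0 *.
have St : t ^+ 2 * pairing D U V U V <= t * S.
  apply: le_trans (ler_wpM2l (sqr_ge0 t) UU) _.
  by rewrite expr2 !mulrA -(mulrA t t) mulVf ?gt_eqF// mulr1.
have : t * S <= pairing D u v u v by nra.
by rewrite ler_pdivrMl.
Qed.

End Square_integrable.
(* Explicit, so that it fixes the measurable structure on the carrier before the
   other arguments are unified. *)
Arguments integrable_EFinD {d T R} mu {D} mD [f g].
Arguments integrable_EFinB {d T R} mu {D} mD [f g].
Arguments integrable_EFinZ {d T R} mu {D} mD a [f].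
Arguments square_integrable_mul {d T R} mu {D} mD [f g].
Arguments square_integrableB {d T R} mu {D} mD [f g].
Arguments bounded_square_integrable {d T R} mu {D} mD [f].
Arguments pairing_integrable {d T R} mu {D} mD [u v p q].
Arguments pairing {d T R} mu D u v p q.
Arguments square_integrable {d T R} mu D f.

(** * First and second derivative tests for oscillatory integrals *)

Section van_der_Corput.
Context {R : realType}.
Local Notation mu := (@lebesgue_measure R).
Implicit Types (f phi P dP : R -> R) (p q : R).

Lemma continuous_itv_within f p q :
  (forall x, x \in `[p, q] -> {for x, continuous f}) ->
  {within `[p, q], continuous f}.
Proof.
by move=> cf; apply: continuous_in_subspaceT => x; rewrite inE => /cf.
Qed.

Lemma continuous_itv_integrable f p q :
  (forall x, x \in `[p, q] -> {for x, continuous f}) ->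
  mu.-integrable `[p, q] (EFin \o f).
Proof.
move=> cf; apply: continuous_compact_integrable; first exact: segment_compact.
exact: continuous_itv_within.
Qed.

(** By the mean value theorem $P - \int f$ does not decrease from $p$ to $q$. Only [f] is
    integrated: the derivative of $\sin \phi / \phi'$, which contains $\phi''$, enters through a
    pointwise inequality alone. *)
Lemma le_Rintegral_increment f P dP p q : p <= q ->
  (forall x, x \in `[p, q] -> {for x, continuous f}) ->
  (forall x, x \in `[p, q] -> is_derive x 1 P (dP x)) ->
  (forall x, x \in `[p, q] -> f x <= dP x) ->
  \int[mu]_(x in `[p, q]) f x <= P q - P p.
Proof.
move=> pq cf dPP fdP.
have [->|pq'] := eqVneq p q; first by rewrite set_itv1 Rintegral_set1 subrr.
have {}pq' : p < q by rewrite lt_neqAle pq' pq.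
pose J y := (\int[mu]_(x in `[p, y]) f x)%R.
have if_ := continuous_itv_integrable cf.
have dJ x : x \in `]p, q[ -> is_derive x 1 (fun y => P y - J y) (dP x - f x).
  move=> xpq; have xpq' : x \in `[p, q] by apply: subset_itv_oo_cc xpq.
  apply: is_deriveB; first exact: dPP.
  move: (xpq); rewrite in_itv/= => /andP[px xq].
  have [dJ J'] : derivable J x 1 /\ derive1 J x = f x.
    exact: (continuous_FTC1_closed xq if_ px (cf _ xpq')).
  by rewrite -J' derive1E; exact/derivableP.
have cPJ : {within `[p, q], continuous (fun y => P y - J y)}.
  have cJ : {within `[p, q], continuous J}.
    exact: parameterized_integral_continuous.
  have cP : {within `[p, q], continuous P}.
    apply: continuous_itv_within => x /dPP dPx; apply: differentiable_continuous.
    exact/derivable1_diffP.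
  by move=> x; apply: continuousB; [exact: cP|exact: cJ].
have [c cpq] := MVT pq' dJ cPJ.
have -> : J p = 0 by rewrite /J set_itv1 Rintegral_set1.
rewrite subr0 => E; rewrite -subr_ge0 addrAC E mulr_ge0 ?subr_ge0//.
by apply: fdP; exact: subset_itv_oo_cc cpq.
Qed.

Section phase.
Variables (phi phi1 phi2 : R -> R) (p q : R).
Hypothesis dphi : forall x, x \in `[p, q] -> is_derive x 1 phi (phi1 x).
Hypothesis dphi1 : forall x, x \in `[p, q] -> is_derive x 1 phi1 (phi2 x).

Lemma is_derive1_continuous f (x a : R) : is_derive x 1 f a -> {for x, continuous f}.
Proof.
by move=> dfx; apply: differentiable_continuous; exact/derivable1_diffP.
Qed.

Lemma continuous_cos_phase x : x \in `[p, q] -> {for x, continuous (cos \o phi)}.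
Proof.
move=> /dphi /is_derive1_continuous cphi.
by apply: continuous_comp => //; exact: continuous_cos.
Qed.

(* Since [phi2 >= 0], the derivative of [(sin phi + a) / phi1] differs from
   [cos phi] by [- (sin phi + a) * phi2 / phi1 ^+ 2], of constant sign for [a = 1, -1]. *)
Lemma van_der_Corput1 (rho : R) : p <= q -> 0 < rho ->
  (forall x, x \in `[p, q] -> 0 <= phi2 x) ->
  (forall x, x \in `[p, q] -> rho <= `|phi1 x|) ->
  `|\int[mu]_(x in `[p, q]) cos (phi x)| <= 4 / rho.
Proof.
move=> pq rho0 phi2_ge0 phi1_ge.
have ppq : p \in `[p, q] by rewrite in_itv/= lexx.
have qpq : q \in `[p, q] by rewrite in_itv/= lexx pq.
have dP a x : x \in `[p, q] ->
  is_derive x 1 (fun y => (sin (phi y) + a) * (phi1 y)^-1)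
    (cos (phi x) - (sin (phi x) + a) * (phi2 x / phi1 x ^+ 2)).
  move=> xpq; have d0 := dphi xpq; have d1 := dphi1 xpq.
  have n0 : phi1 x != 0.
    by rewrite -normr_gt0 (lt_le_trans rho0)// phi1_ge.
  apply: is_derive_eq; rewrite /GRing.scale/= -!exprVn; field; exact: n0.
(* For $a = \pm 1$ each of the two boundary terms is at most $2 / \rho$, whence the constant $4 /
   \rho$. *)
have bP a x : `|a| <= 1 -> x \in `[p, q] ->
    `|(sin (phi x) + a) * (phi1 x)^-1| <= 2 / rho.
  move=> a1 xpq; rewrite normrM ler_pM//.
    apply: le_trans (ler_normD _ _) _; rewrite [leRHS](_ : 2 = 1 + 1)//.
    apply: lerD => //; rewrite ler_norml sin_geN1 sin_le1//.
  by rewrite normfV lef_pV2 ?phi1_ge// posrE// (lt_le_trans rho0)// phi1_ge.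
have ico := continuous_itv_integrable continuous_cos_phase.
have n1 : `|1 : R| <= 1 by rewrite normr1.
have nN1 : `|-1 : R| <= 1 by rewrite normrN1.
have nn : forall b : R, `|b| <= 2 / rho -> b <= 2 / rho /\ - (2 / rho) <= b.
  by move=> b; rewrite ler_norml => /andP[].
rewrite ler_norml; apply/andP; split.
- rewrite lerNl.
  have : (\int[mu]_(x in `[p, q]) (- cos (phi x)) <=
    - ((sin (phi q) + 1) * (phi1 q)^-1) - - ((sin (phi p) + 1) * (phi1 p)^-1))%R.
    apply: (@le_Rintegral_increment (fun x => - cos (phi x)) (fun y => - ((sin (phi y) + 1) * (phi1 y)^-1))
      (fun x => - (cos (phi x) - (sin (phi x) + 1) * (phi2 x / phi1 x ^+ 2))) _ _ pq).
    + by move=> x xpq; apply: continuousN; exact: continuous_cos_phase.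
    + by move=> x xpq; apply: is_deriveN; exact: dP.
    + move=> x xpq; rewrite lerN2 gerBl mulr_ge0//.
      by rewrite divr_ge0 ?sqr_ge0// phi2_ge0.
  have -> : (\int[mu]_(x in `[p, q]) (- cos (phi x)) =
      - \int[mu]_(x in `[p, q]) cos (phi x))%R.
    rewrite -mulN1r -RintegralZl//; apply: eq_Rintegral => x _; by rewrite mulN1r.
  have /nn[] := bP 1 q n1 qpq.
  have /nn[] := bP 1 p n1 ppq.
  lra.
- have : (\int[mu]_(x in `[p, q]) (cos (phi x)) <=
    ((sin (phi q) + -1) * (phi1 q)^-1) - ((sin (phi p) + -1) * (phi1 p)^-1))%R.
    apply: (@le_Rintegral_increment (fun x => cos (phi x)) (fun y => ((sin (phi y) + -1) * (phi1 y)^-1))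
      (fun x => (cos (phi x) - (sin (phi x) + -1) * (phi2 x / phi1 x ^+ 2))) _ _ pq).
    + exact: continuous_cos_phase.
    + move=> x xpq; rewrite lerBrDr gerDl mulr_le0_ge0//.
      by rewrite divr_ge0 ?sqr_ge0// phi2_ge0.
  have /nn[] := bP (-1) q nN1 qpq.
  have /nn[] := bP (-1) p nN1 ppq.
  lra.
Qed.

End phase.

Lemma le_norm_itv_integral (f : R -> R) (a b : R) : a <= b ->
  (forall x, x \in `[a, b] -> {for x, continuous f}) ->
  (forall x, `|f x| <= 1) ->
  `|\int[mu]_(x in `[a, b]) f x| <= b - a.
Proof.
move=> ab cf f1; have iF := continuous_itv_integrable cf.
apply: le_trans (le_normr_Rintegral _ iF) _ => //.
have -> : b - a = (\int[mu]_(x in `[a, b]) 1)%R.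
  rewrite Rintegral_cst//= lebesgue_measure_itv/= lte_fin mul1r.
  by case: ltgtP ab => // ->; rewrite subrr.
apply: le_Rintegral => //; first exact: integrable_norm.
by apply: continuous_itv_integrable => x _; exact: cvg_cst.
Qed.

Lemma Rintegral_itv_chasles (f : R -> R) (a b c : R) : a <= b -> b <= c ->
  (forall x, x \in `[a, c] -> {for x, continuous f}) ->
  (\int[mu]_(x in `[a, c]) f x =
   \int[mu]_(x in `[a, b]) f x + \int[mu]_(x in `[b, c]) f x)%R.
Proof.
move=> ab bc cf; have iF := continuous_itv_integrable cf.
apply/eqP; rewrite addrC -subr_eq; apply/eqP.
rewrite Rintegral_itvB ?bnd_simp// Rintegral_itv_obnd_cbnd//.
apply: integrableS iF => //.
by apply: subset_itv; rewrite bnd_simp.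
Qed.

Section phase2.
Variables (phi phi1 phi2 : R -> R) (p q : R).
Hypothesis dphi : forall x, x \in `[p, q] -> is_derive x 1 phi (phi1 x).
Hypothesis dphi1 : forall x, x \in `[p, q] -> is_derive x 1 phi1 (phi2 x).

(* Outside the [delta]-neighbourhood of the point where [phi1] is closest to
   zero, [`|phi1| >= nu * delta]. *)
Lemma van_der_Corput2 (nu delta : R) : p <= q -> 0 < nu -> 0 < delta ->
  (forall x, x \in `[p, q] -> nu <= phi2 x) ->
  `|\int[mu]_(x in `[p, q]) cos (phi x)| <= 2 * delta + 8 / (nu * delta).
Proof.
move=> pq nu0 delta0 phi2_ge.
have ppq : p \in `[p, q] by rewrite in_itv/= lexx.
have qpq : q \in `[p, q] by rewrite in_itv/= lexx pq.
have cphi1 x : x \in `[p, q] -> {for x, continuous phi1}.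
  by move=> /dphi1/is_derive1_continuous.
have mono x y : x \in `[p, q] -> y \in `[p, q] -> x <= y ->
    nu * (y - x) <= phi1 y - phi1 x.
  move=> + + xy; rewrite !in_itv/= => /andP[px xq] /andP[py yq].
  have sub z : z \in `[x, y] -> z \in `[p, q].
    by rewrite !in_itv/= => /andP[xz zy]; rewrite (le_trans px)//= (le_trans zy).
  have d1 z : z \in `]x, y[ -> is_derive z 1 phi1 (phi2 z).
    by move=> zxy; apply: dphi1; apply: sub; exact: subset_itv_oo_cc zxy.
  have c1 : {within `[x, y], continuous phi1}.
    by apply: continuous_itv_within => z /sub/cphi1.
  have [c cxy ->] := MVT_segment xy d1 c1.
  by rewrite ler_wpM2r ?subr_ge0// phi2_ge// sub.
(* Since [phi1] grows with slope at least [nu], [c] is its zero if it has one, and otherwise the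
   endpoint where it is closest to zero. *)
have [c cpq cP] : exists2 c, c \in `[p, q] &
    forall x, x \in `[p, q] -> nu * `|x - c| <= `|phi1 x|.
  have [p0|p0] := leP 0 (phi1 p).
    exists p => // x xpq; have px : p <= x by move: xpq; rewrite in_itv/= => /andP[].
    rewrite ger0_norm ?subr_ge0//; apply: le_trans (ler_norm _).
    by have := mono _ _ ppq xpq px; lra.
  have [q0|q0] := leP (phi1 q) 0.
    exists q => // x xpq; have xq : x <= q by move: xpq; rewrite in_itv/= => /andP[].
    rewrite distrC ger0_norm ?subr_ge0// -normrN; apply: le_trans (ler_norm _).
    by have := mono _ _ xpq qpq xq; lra.
  have [c cpq c0] : exists2 c, c \in `[p, q] & phi1 c = 0.
    apply: (IVT pq (continuous_itv_within cphi1)).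
    by rewrite ge_min le_max !(ltW p0, ltW q0)/= orbT.
  exists c => // x xpq; case: (leP x c) => xc.
    rewrite distrC ger0_norm ?subr_ge0// -normrN; apply: le_trans (ler_norm _).
    by have := mono _ _ xpq cpq xc; lra.
  rewrite ger0_norm ?subr_ge0 ?(ltW xc)//; apply: le_trans (ler_norm _).
  by have := mono _ _ cpq xpq (ltW xc); lra.
move: (cpq); rewrite in_itv/= => /andP[pc cq].
(* The neighbourhood of [c] is clipped to $[p, q]$. Each outer piece is either reduced to a point or
   begins at distance exactly [delta] from [c]. *)
pose p' := Num.max p (c - delta); pose q' := Num.min q (c + delta).
have pp' : p <= p' by rewrite le_max lexx.
have qq' : q' <= q by rewrite ge_min lexx.
have p'c : p' <= c by rewrite ge_max pc/= lerBlDr lerDl ltW.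
have cq' : c <= q' by rewrite le_min cq/= lerDl ltW.
have p'q' : p' <= q' by exact: le_trans cq'.
have cc := continuous_cos_phase dphi.
have cp'q x : x \in `[p', q] -> {for x, continuous (cos \o phi)}.
  rewrite in_itv/= => /andP[p'x xq]; apply: cc.
  by rewrite in_itv/= xq (le_trans pp').
rewrite (Rintegral_itv_chasles pp' (le_trans p'q' qq') cc).
rewrite (Rintegral_itv_chasles p'q' qq' cp'q).
have nd0 : 0 < nu * delta by exact: mulr_gt0.
have h1 : `|\int[mu]_(x in `[p, p']) cos (phi x)| <= 4 / (nu * delta).
  have [p'p|p'p] := eqVneq p' p.
    by rewrite p'p set_itv1 Rintegral_set1 normr0 divr_ge0// ltW.
  have p'E : p' = c - delta.
    by move: p'p; rewrite /p'; case: leP => // _; rewrite eqxx.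
  have sub x : x \in `[p, p'] -> x \in `[p, q].
    by rewrite !in_itv/= => /andP[-> xp']; rewrite (le_trans xp')// (le_trans p'q').
  apply: (van_der_Corput1 (fun x h => dphi (sub x h)) (fun x h => dphi1 (sub x h)) pp' nd0).
  - by move=> x /sub xpq; rewrite (le_trans (ltW nu0))// phi2_ge.
  - move=> x xpp'; apply: le_trans (cP _ (sub _ xpp')); rewrite ler_pM2l//.
    move: xpp'; rewrite in_itv/= p'E => /andP[_ xc].
    by rewrite distrC (le_trans _ (ler_norm _))// lerBrDl -lerBrDr.
have h3 : `|\int[mu]_(x in `[q', q]) cos (phi x)| <= 4 / (nu * delta).
  have [q'q|q'q] := eqVneq q' q.
    by rewrite q'q set_itv1 Rintegral_set1 normr0 divr_ge0// ltW.
  have q'E : q' = c + delta.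
    by move: q'q; rewrite /q'; case: leP => // _; rewrite eqxx.
  have sub x : x \in `[q', q] -> x \in `[p, q].
    by rewrite !in_itv/= => /andP[q'x ->]; rewrite (le_trans pp')// (le_trans p'q').
  apply: (van_der_Corput1 (fun x h => dphi (sub x h)) (fun x h => dphi1 (sub x h)) qq' nd0).
  - by move=> x /sub xpq; rewrite (le_trans (ltW nu0))// phi2_ge.
  - move=> x xq'q; apply: le_trans (cP _ (sub _ xq'q)); rewrite ler_pM2l//.
    move: xq'q; rewrite in_itv/= q'E => /andP[xc _].
    by rewrite (le_trans _ (ler_norm _))// lerBrDl.
have h2 : `|\int[mu]_(x in `[p', q']) cos (phi x)| <= 2 * delta.
  apply: (@le_trans _ _ (q' - p')).
    apply: (@le_norm_itv_integral (cos \o phi)) => //.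
    - move=> x; rewrite in_itv/= => /andP[p'x xq']; apply: cc.
      by rewrite in_itv/= (le_trans pp')//= (le_trans xq').
    - by move=> x; rewrite ler_norml cos_geN1 cos_le1.
  have q'_le : q' <= c + delta by rewrite ge_min lexx orbT.
  have p'_ge : c - delta <= p' by rewrite le_max lexx orbT.
  by lra.
have -> : 8 / (nu * delta) = 4 / (nu * delta) + 4 / (nu * delta) by lra.
apply: le_trans (ler_normD _ _) _.
have := ler_normD (\int[mu]_(x in `[p', q']) cos (phi x)) (\int[mu]_(x in `[q', q]) cos (phi x)).
by move: h1 h2 h3; set w := 4 / (nu * delta); lra.
Qed.

End phase2.
End van_der_Corput.

(** * Derivative tests for the phase $a x + b x^m$ on one dyadic interval *)

Section dispersive_phase.
Context {R : realType}.
Local Notation mu := (@lebesgue_measure R).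

Section half_line.
Variables (m lam q : R).
Hypotheses (m1 : 1 < m) (lam0 : 0 < lam) (lamq : lam <= q) (q2 : q <= 2 * lam).

Let m_gt0 : 0 < m. Proof. exact: lt_trans m1. Qed.
Let m_ge0 : 0 <= m. Proof. exact: ltW. Qed.
Let m1_gt0 : 0 < m - 1. Proof. by rewrite subr_gt0. Qed.
Let m1_ge0 : 0 <= m - 1. Proof. exact: ltW. Qed.

Let cosint (a b : R) : R := (\int[mu]_(x in `[lam, q]) cos (a * x + b * x `^ m))%R.

Let dphase (a b : R) x : x \in `[lam, q] ->
  is_derive x 1 (fun x : R => a * x + b * x `^ m : R) (a + b * (m * x `^ (m - 1))).
Proof.
rewrite in_itv/= => /andP[lx _]; have x0 : 0 < x by exact: lt_le_trans lx.
have h := is_derive1_powR m x0.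
by apply: is_derive_eq; rewrite /GRing.scale/= mulr1.
Qed.

Let dphase1 (a b : R) x : x \in `[lam, q] ->
  is_derive x 1 (fun x : R => a + b * (m * x `^ (m - 1)) : R)
    (b * (m * ((m - 1) * x `^ (m - 1 - 1)))).
Proof.
rewrite in_itv/= => /andP[lx _]; have x0 : 0 < x by exact: lt_le_trans lx.
have h := is_derive1_powR (m - 1) x0.
apply: (is_derive_eq (is_deriveD (is_derive_cst a x 1) (is_deriveZ b (is_deriveZ m h)))).
by rewrite /GRing.scale/= add0r.
Qed.

Let cosintN a b : cosint (- a) (- b) = cosint a b.
Proof. by apply: eq_Rintegral => x _; rewrite !mulNr -opprD cosN. Qed.

Lemma cos_phase_trivial a b : `|cosint a b| <= lam.
Proof.
apply: (@le_trans _ _ (q - lam)); last first.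
  by rewrite lerBlDr (le_trans q2)// mulr2n mulrDl mul1r.
apply: (le_norm_itv_integral (f := fun x => cos (a * x + b * x `^ m)) lamq).
- exact: (continuous_cos_phase (@dphase a b)).
- by move=> x; rewrite ler_norml cos_geN1 cos_le1.
Qed.

(** The hypothesis keeps $b m x^{m-1}$ below $|a| / 2$ on all of $[\lambda, 2\lambda]$, so the
    derivative of the phase is at least $|a| / 2$ in absolute value; $b \ge 0$ gives its second
    derivative the sign required by the first derivative test. *)
Let cos_phase_decay1_ge0 a b : 0 <= b -> a != 0 ->
  2 * m * `|b| * (2 `^ (m - 1) * lam `^ (m - 1)) <= `|a| ->
  `|cosint a b| <= 8 / `|a|.
Proof.
move=> b0 a0 ab.
have a0' : 0 < `|a| by rewrite normr_gt0.
have -> : 8 / `|a| = 4 / (`|a| / 2) by field; rewrite gt_eqF.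
have a2 : 0 < `|a| / 2 by rewrite divr_gt0.
apply: (van_der_Corput1 (@dphase a b) (@dphase1 a b) lamq a2).
- by move=> x _; rewrite !mulr_ge0 ?powR_ge0.
- move=> x; rewrite in_itv/= => /andP[lx xq].
  have x0 : 0 < x by exact: lt_le_trans lx.
  have xp : x `^ (m - 1) <= 2 `^ (m - 1) * lam `^ (m - 1).
    have l2 : 0 <= 2 * lam by rewrite mulr_ge0// ltW.
    rewrite -(powRM (m - 1) (ler0n R 2) (ltW lam0)).
    by apply: (ge0_ler_powR m1_ge0); rewrite ?nnegrE ?(ltW x0) ?(le_trans xq).
  have h : b * (m * x `^ (m - 1)) <= `|a| / 2.
    rewrite ger0_norm// in ab; rewrite ler_pdivlMr//; apply: le_trans ab.
    rewrite [leLHS](_ : _ = 2 * m * b * x `^ (m - 1)); last by ring.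
    by rewrite ler_wpM2l// !mulr_ge0.
  have h0 : 0 <= b * (m * x `^ (m - 1)).
    by rewrite !mulr_ge0 ?powR_ge0.
  have := lerB_normD a (b * (m * x `^ (m - 1))).
  by rewrite (ger0_norm h0); lra.
Qed.

Lemma cos_phase_decay1 a b : a != 0 ->
  2 * m * `|b| * (2 `^ (m - 1) * lam `^ (m - 1)) <= `|a| ->
  `|cosint a b| <= 8 / `|a|.
Proof.
move=> a0 ab; have [b0|b0] := leP 0 b; first exact: cos_phase_decay1_ge0.
rewrite -cosintN -(normrN a); apply: cos_phase_decay1_ge0.
- by rewrite oppr_ge0 ltW.
- by rewrite oppr_eq0.
- by rewrite !normrN.
Qed.

Let cos_phase_decay2_gt0 a b delta : 0 < b -> 0 < delta ->
  `|cosint a b| <= 2 * delta + 16 * lam / (m * (m - 1) * `|b| * lam `^ (m - 1) * delta).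
Proof.
move=> b0 d0; rewrite (gtr0_norm b0).
(* A lower bound for $b m (m - 1) x^{m-2}$. Writing $x^{m-2} = x^{m-1} / x$ treats $m < 2$ and $m
   \ge 2$ alike, at the cost of a factor 2. *)
pose nu := b * m * (m - 1) * lam `^ (m - 1) / (2 * lam).
have L0 : 0 < lam `^ (m - 1) by exact: powR_gt0.
have nu0 : 0 < nu.
  by rewrite /nu divr_gt0 ?mulr_gt0.
have -> : 16 * lam / (m * (m - 1) * b * lam `^ (m - 1) * delta) = 8 / (nu * delta).
  by rewrite /nu; field; rewrite !gt_eqF.
apply: (van_der_Corput2 (@dphase a b) (@dphase1 a b) lamq nu0 d0).
move=> x; rewrite in_itv/= => /andP[lx xq].
have x0 : 0 < x by exact: lt_le_trans lx.
have -> : x `^ (m - 1 - 1) = x `^ (m - 1) / x.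
  by rewrite (@powRB _ x (m - 1) 1) ?(powRr1 (ltW x0))// (gt_eqF x0) implybT.
have h1 : lam `^ (m - 1) <= x `^ (m - 1).
  by apply: (ge0_ler_powR m1_ge0); rewrite ?nnegrE ?(ltW x0) ?(ltW lam0).
have h2 : lam `^ (m - 1) / (2 * lam) <= x `^ (m - 1) / x.
  rewrite ler_pM// ?(ltW L0) ?invr_ge0 ?mulr_ge0 ?(ltW lam0)//.
  by rewrite lef_pV2 ?posrE ?mulr_gt0// (le_trans xq).
have h3 : 0 <= b * m * (m - 1) by rewrite !mulr_ge0// ltW.
rewrite [leRHS](_ : _ = b * m * (m - 1) * (x `^ (m - 1) / x)); last by ring.
by rewrite /nu -(mulrA (b * m * (m - 1))) ler_wpM2l.
Qed.

Lemma cos_phase_decay2 a b delta : b != 0 -> 0 < delta ->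
  `|cosint a b| <= 2 * delta + 16 * lam / (m * (m - 1) * `|b| * lam `^ (m - 1) * delta).
Proof.
move=> b0 d0; have [b0'|b0'] := ltP 0 b; first exact: cos_phase_decay2_gt0.
rewrite -cosintN -(normrN b); apply: cos_phase_decay2_gt0 => //.
by rewrite oppr_gt0 lt_neqAle b0.
Qed.

End half_line.
End dispersive_phase.

(** * Decay of the kernel of $T T^*$ on one dyadic annulus *)

Section dispersive_kernel.
Context {R : realType}.
Local Notation mu := (@lebesgue_measure R).

Definition cos_phase (m lam q a b : R) : R :=
  (\int[mu]_(x in `[lam, q]) cos (a * x + b * x `^ m))%R.

(** Uniform in [b], by a dichotomy. If $|b| \lambda^{m-1}$ is small against $|a|$, there is no
    stationary point, and the geometric mean of the trivial bound $\lambda$ and of $8 / |a|$ is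
    enough, with $\sqrt 8 \le 3$. If not, the second derivative is at least of order $|a| /
    \lambda$, and the second derivative test applies with $\delta = \sqrt{\lambda / |a|}$. *)
Lemma cos_phase_sqrt_linear (m lam q a b : R) :
  1 < m -> 0 < lam -> lam <= q -> q <= 2 * lam -> a != 0 ->
  `|cos_phase m lam q a b| <=
    (5 + 32 * 2 `^ (m - 1) / (m - 1)) * Num.sqrt (lam / `|a|).
Proof.
move=> m1 lam0 lamq q2 a0.
have m10 : 0 < m - 1 by rewrite subr_gt0.
have m0 : 0 < m by exact: lt_trans m1.
have a0' : 0 < `|a| by rewrite normr_gt0.
have L0 : 0 < lam `^ (m - 1) by exact: powR_gt0.
have T0 : 0 < 2 `^ (m - 1) :> R by exact: powR_gt0.
set delta := Num.sqrt _.
have d0 : 0 < delta by rewrite sqrtr_gt0 divr_gt0.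
have dd : delta ^+ 2 = lam / `|a| by rewrite sqr_sqrtr// divr_ge0// ltW.
have W0 : 0 <= 32 * 2 `^ (m - 1) / (m - 1) by rewrite divr_ge0 ?mulr_ge0 ?ltW.
have [ab|ab] := leP (2 * m * `|b| * (2 `^ (m - 1) * lam `^ (m - 1))) `|a|.
  have h1 := cos_phase_trivial m lam0 lamq q2 a b.
  have h2 := cos_phase_decay1 m1 lam0 lamq q2 a0 ab.
  rewrite -/(cos_phase m lam q a b) in h1 h2.
  apply: (@le_trans _ _ (3 * delta)); last by rewrite ler_wpM2r ?(ltW d0)//; lra.
  rewrite -(@ler_pXn2r _ 2%N)// ?nnegrE ?mulr_ge0 ?(ltW d0)// exprMn dd.
  apply: (@le_trans _ _ (lam * (8 / `|a|))); first by rewrite expr2 ler_pM.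
  have : 0 <= lam / `|a| by rewrite divr_ge0// ltW.
  by rewrite mulrCA; lra.
have b0 : b != 0.
  by apply: contraTneq ab => ->; rewrite normr0 mulr0 mul0r ltNge ltW.
have b0' : 0 < `|b| by rewrite normr_gt0.
have h := cos_phase_decay2 m1 lam0 lamq q2 a b0 d0.
rewrite -/(cos_phase m lam q a b) in h.
apply: (le_trans h).
have -> : 16 * lam / (m * (m - 1) * `|b| * lam `^ (m - 1) * delta) =
    (32 * 2 `^ (m - 1) / (m - 1)) *
    (lam / (2 * m * `|b| * (2 `^ (m - 1) * lam `^ (m - 1)))) / delta.
  by field; rewrite !gt_eqF.
have hh : lam / (2 * m * `|b| * (2 `^ (m - 1) * lam `^ (m - 1))) / delta <= delta.
  rewrite ler_pdivrMr// -expr2 dd ler_pM2l// lef_pV2 ?posrE ?mulr_gt0//.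
  exact: ltW.
have := ler_wpM2l W0 hh; rewrite mulrA.
by lra.
Qed.

(** Uniform in [a]: this $\delta$ balances the two terms of the second derivative test. *)
Lemma cos_phase_sqrt_power (m lam q a b : R) :
  1 < m -> 0 < lam -> lam <= q -> q <= 2 * lam -> b != 0 ->
  `|cos_phase m lam q a b| <=
    (2 + 16 / (m * (m - 1))) * Num.sqrt (lam / (`|b| * lam `^ (m - 1))).
Proof.
move=> m1 lam0 lamq q2 b0.
have m10 : 0 < m - 1 by rewrite subr_gt0.
have m0 : 0 < m by exact: lt_trans m1.
have b0' : 0 < `|b| by rewrite normr_gt0.
have L0 : 0 < lam `^ (m - 1) by exact: powR_gt0.
set delta := Num.sqrt _.
have bL0 : 0 < `|b| * lam `^ (m - 1) by rewrite mulr_gt0.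
have d0 : 0 < delta by rewrite sqrtr_gt0 divr_gt0.
have dd : delta ^+ 2 = lam / (`|b| * lam `^ (m - 1)).
  by rewrite sqr_sqrtr// divr_ge0// ltW.
have h := cos_phase_decay2 m1 lam0 lamq q2 a b0 d0.
rewrite -/(cos_phase m lam q a b) in h.
apply: (le_trans h); rewrite [leRHS]mulrDl lerD2l.
have -> : 16 * lam / (m * (m - 1) * `|b| * lam `^ (m - 1) * delta) =
    16 / (m * (m - 1)) * (lam / (`|b| * lam `^ (m - 1))) / delta.
  by field; rewrite !gt_eqF.
by rewrite -dd expr2 -!mulrA mulfV ?mulr1// gt_eqF.
Qed.

Lemma ge0_ler_powRN (x y e : R) : 0 < x -> x <= y -> 0 <= e -> y `^ (- e) <= x `^ (- e).
Proof.
move=> x0 xy e0; have y0 : 0 < y by exact: lt_le_trans xy.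
rewrite !powRN lef_pV2 ?posrE ?powR_gt0//.
by apply: (ge0_ler_powR e0); rewrite ?nnegrE ?(ltW x0) ?(ltW y0).
Qed.

(** Serves with $D = |x - y| \le 2$: the singularities met in the two cases of the kernel bound are
    brought to the same exponent $\alpha$. *)
Lemma powRN_le_exponent (D e alpha : R) : 0 < D -> D <= 2 -> e <= alpha ->
  D `^ (- e) <= 2 `^ (alpha - e) * D `^ (- alpha).
Proof.
move=> D0 D2 ea.
rewrite [in leLHS](_ : - e = (alpha - e) + - alpha); last by ring.
rewrite powRD; last by rewrite (gt_eqF D0) implybT.
rewrite ler_wpM2r ?powR_ge0//; apply: ge0_ler_powR => //; rewrite ?nnegrE ?subr_ge0//.
exact: ltW.
Qed.

(* The hypothesis on [a] is what the definition of $\Gamma(\kappa)$ gives for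
   $a = \gamma(x, t) - \gamma(y, t')$, $b = t - t'$ and $D = |x - y|$.
   Either [`|a|] is comparable to [D], or [`|b|] is at least a multiple of
   $D^{1/\kappa}$; in the second case the bound is interpolated, with
   weight [theta], with the trivial bound [lam]. *)
Lemma dispersive_kernel_bound (m kappa C1 C2 theta sigma alpha : R) :
  1 < m -> 0 < kappa -> 0 < C1 -> 0 < C2 -> 0 <= theta -> theta <= 1 ->
  1 - theta * m / 2 <= 2 * sigma -> theta / (2 * kappa) <= alpha ->
  2^-1 <= alpha -> 2^-1 <= 2 * sigma ->
  exists C : R, 0 <= C /\ forall lam q a b D : R,
    1 <= lam -> lam <= q -> q <= 2 * lam -> 0 < D -> D <= 2 ->
    D / C2 - C1 * `|b| `^ kappa <= `|a| ->
    `|cos_phase m lam q a b| <= C * lam `^ (2 * sigma) * D `^ (- alpha).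
Proof.
move=> m1 k0 C10 C20 th0 th1 hsig htk ha hs.
have m10 : 0 < m - 1 by rewrite subr_gt0.
have m0 : 0 < m by exact: lt_trans m1.
pose Ca := 5 + 32 * 2 `^ (m - 1) / (m - 1).
pose Cb := 2 + 16 / (m * (m - 1)).
have Ca0 : 0 <= Ca.
  by rewrite /Ca addr_ge0// divr_ge0 ?mulr_ge0 ?powR_ge0 ?ltW.
have Cb0 : 0 <= Cb by rewrite /Cb addr_ge0// divr_ge0 ?mulr_ge0 ?ltW.
pose e := theta / (2 * kappa).
(* If $c_0 |b|^\kappa \le D$, then $C_1 |b|^\kappa$ is at most half of $D / C_2$, and $|a| \ge D /
   (2 C_2)$ is left. *)
pose c0 := 2 * C1 * C2.
have c00 : 0 < c0 by rewrite /c0 !mulr_gt0.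
pose CA := Ca * Num.sqrt (2 * C2) * 2 `^ (alpha - 2^-1).
pose CB := Cb `^ theta * c0 `^ e * 2 `^ (alpha - e).
have CA0 : 0 <= CA by rewrite /CA !mulr_ge0 ?sqrtr_ge0 ?powR_ge0.
have CB0 : 0 <= CB by rewrite /CB !mulr_ge0 ?powR_ge0.
exists (CA + CB); split; first exact: addr_ge0.
move=> lam q a b D lam1 lamq q2 D0 D2 hab.
have lam0 : 0 < lam by exact: lt_le_trans lam1.
have LL0 : 0 <= lam `^ (2 * sigma) * D `^ (- alpha) by rewrite mulr_ge0 ?powR_ge0.
have half0 : 0 < 2^-1 :> R by rewrite invr_gt0.
have [hb|hb] := leP (c0 * `|b| `^ kappa) D.
- suff : `|cos_phase m lam q a b| <= CA * (lam `^ (2 * sigma) * D `^ (- alpha)).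
    by move=> h; rewrite -mulrA mulrDl (le_trans h)// lerDl mulr_ge0.
  have aD : D / (2 * C2) <= `|a|.
    apply: le_trans hab.
    have : C1 * `|b| `^ kappa <= D / (2 * C2).
      by rewrite ler_pdivlMr ?mulr_gt0//; apply: le_trans hb; rewrite /c0; lra.
    rewrite invfM mulrCA -/(_ / _).
    by have : D / C2 = D / C2 by []; lra.
  have a0' : 0 < `|a| by rewrite (lt_le_trans _ aD)// divr_gt0 ?mulr_gt0.
  have a0 : a != 0 by rewrite -normr_gt0.
  apply: (le_trans (cos_phase_sqrt_linear b m1 lam0 lamq q2 a0)).
  rewrite -/Ca /CA -!mulrA ler_wpM2l//.
  have h1 : lam / `|a| <= (2 * C2) * (lam * D^-1).
    have ia : `|a|^-1 <= (D / (2 * C2))^-1.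
      by rewrite lef_pV2 ?posrE// divr_gt0 ?mulr_gt0.
    have -> : 2 * C2 * (lam * D^-1) = lam * (D / (2 * C2))^-1.
      by field; rewrite !gt_eqF.
    by rewrite ler_wpM2l// ltW.
  apply: (le_trans (ler_wsqrtr h1)).
  have CC0 : 0 <= 2 * C2 by rewrite mulr_ge0// ltW.
  rewrite (sqrtrM _ CC0) ler_wpM2l ?sqrtr_ge0//.
  rewrite (sqrtrM _ (ltW lam0)) -!powR12_sqrt ?invr_ge0 ?(ltW lam0) ?(ltW D0)//.
  rewrite mulrCA ler_pM ?powR_ge0//.
    by rewrite ler_powR.
  rewrite -powR_inv1 ?(ltW D0)// -powRrM mulN1r.
  exact: powRN_le_exponent.
- suff : `|cos_phase m lam q a b| <= CB * (lam `^ (2 * sigma) * D `^ (- alpha)).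
    by move=> h; rewrite -mulrA mulrDl (le_trans h)// lerDr mulr_ge0.
  have b0 : b != 0.
    apply: contraTneq hb => ->; rewrite normr0 powR0 ?gt_eqF// mulr0 -leNgt.
    exact: ltW.
  have b0' : 0 < `|b| by rewrite normr_gt0.
  (* The lower bound for $|b|$ when $c_0 |b|^\kappa > D$. *)
  pose beta := (D / c0) `^ kappa^-1.
  have beta0 : 0 < beta by rewrite powR_gt0// divr_gt0.
  have bb : beta <= `|b|.
    have -> : `|b| = (`|b| `^ kappa) `^ kappa^-1.
      by rewrite -powRrM divff ?gt_eqF// powRr1.
    apply: ge0_ler_powR; rewrite ?nnegrE ?invr_ge0 ?powR_ge0 ?divr_ge0 ?(ltW k0) ?(ltW D0) ?(ltW c00)//.
    by rewrite ler_pdivrMr// mulrC ltW.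
  have h1 := cos_phase_trivial m lam0 lamq q2 a b.
  have h2 := cos_phase_sqrt_power a m1 lam0 lamq q2 b0.
  rewrite -/(cos_phase m lam q a b) in h1.
  set K := `|_| in h1 h2 *; have K0 : 0 <= K by exact: normr_ge0.
  have L0 : 0 < lam `^ (m - 1) by exact: powR_gt0.
  have h3 : K <= Cb * (lam / (beta * lam `^ (m - 1))) `^ 2^-1.
    apply: (le_trans h2); rewrite -/Cb ler_wpM2l// powR12_sqrt; last first.
      by rewrite divr_ge0 ?mulr_ge0 ?ltW.
    apply: ler_wsqrtr; rewrite ler_pM2l// lef_pV2 ?posrE ?mulr_gt0//.
    by rewrite ler_pM2r.
  (* The exponents add up to $(1 - \theta) + \theta (2 - m) / 2 = 1 - \theta m / 2$ for $\lambda$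
     and to $- \theta / (2\kappa) = - e$ for $D$. *)
  have -> : K = K `^ (1 - theta) * K `^ theta.
    by rewrite -powRD ?subrK ?powRr1// oner_eq0.
  apply: (@le_trans _ _ (lam `^ (1 - theta) *
      (Cb * (lam / (beta * lam `^ (m - 1))) `^ 2^-1) `^ theta)).
    apply: ler_pM; rewrite ?powR_ge0//; apply: ge0_ler_powR;
      rewrite ?nnegrE ?subr_ge0 ?mulr_ge0 ?powR_ge0 ?(ltW lam0)//.
  rewrite (powRM _ Cb0 (powR_ge0 _ _)).
  have -> : lam / (beta * lam `^ (m - 1)) = lam `^ (2 - m) * (D / c0) `^ (- kappa^-1).
    rewrite invfM mulrCA -!powRN mulrC; congr (_ * _).
    rewrite -{1}(powRr1 (ltW lam0)) -powRD ?(gt_eqF lam0) ?implybT//.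
    by congr (_ `^ _); ring.
  rewrite -powRrM (@powRM _ (lam `^ (2 - m)) ((D / c0) `^ (- kappa^-1)));
    [|exact: powR_ge0|exact: powR_ge0].
  rewrite -!powRrM.
  rewrite [leLHS](_ : _ = Cb `^ theta * (lam `^ (1 - theta * m / 2) * (D / c0) `^ (- e))); last first.
    rewrite mulrCA; congr (_ * _); rewrite [LHS]mulrA; congr (_ * _).
      rewrite -powRD ?(gt_eqF lam0) ?implybT//; congr (_ `^ _).
      by field.
    by congr (_ `^ _); rewrite /e; field; rewrite gt_eqF.
  have -> : (D / c0) `^ (- e) = D `^ (- e) * c0 `^ e.
    rewrite powRM ?(ltW D0) ?invr_ge0 ?(ltW c00)//; congr (_ * _).
    by rewrite -powR_inv1 ?(ltW c00)// -powRrM mulN1r opprK.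
  have key : lam `^ (1 - theta * m / 2) * D `^ (- e) <=
      lam `^ (2 * sigma) * (2 `^ (alpha - e) * D `^ (- alpha)).
    rewrite ler_pM ?powR_ge0//; first by rewrite ler_powR.
    exact: powRN_le_exponent.
  have Cc0 : 0 <= Cb `^ theta * c0 `^ e by rewrite mulr_ge0 ?powR_ge0.
  move: (ler_wpM2l Cc0 key); rewrite /CB; congr (is_true (_ <= _)).
    by move: (Cb `^ _) (lam `^ _) (D `^ _) (c0 `^ _) => x1 x2 x3 x4; ring.
  by move: (Cb `^ _) (c0 `^ _) (2 `^ _) (lam `^ _) (D `^ _) => x1 x2 x3 x4 x5; ring.
Qed.

End dispersive_kernel.

(** * Riemann sums of Lipschitz functions and sums of $l^{-\alpha}$ *)

Section Riemann_sums.
Context {R : realType}.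
Local Notation mu := (@lebesgue_measure R).

Lemma lipschitz_continuous (F : R -> R) (L : R) :
  (forall x y, `|F x - F y| <= L * `|x - y|) -> continuous F.
Proof.
move=> FL x; have L0 : 0 <= L.
  have := FL 1 0; rewrite subr0 normr1 mulr1; exact: le_trans.
apply/cvgrPdist_lt => e e0; near=> y.
apply: le_lt_trans (FL x y) _.
apply: (@le_lt_trans _ _ ((L + 1) * `|x - y|)).
  by rewrite ler_wpM2r// lerDl.
rewrite -ltr_pdivlMl ?ltr_wpDl//; near: y.
by apply: cvgr_dist_lt; rewrite // mulr_gt0// invr_gt0 ltr_wpDl.
Unshelve. all: by end_near. Qed.

Lemma le_Rintegral_riemann_sum (F : R -> R) (L a w : R) : 0 <= w ->
  (forall x y, `|F x - F y| <= L * `|x - y|) -> forall n,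
  \int[mu]_(x in `[a, a + w *+ n]) F x <= \sum_(j < n) (F (a + w *+ j) + L * w) * w.
Proof.
move=> w0 FL; have cF := lipschitz_continuous FL.
elim=> [|n ih]; first by rewrite mulr0n addr0 set_itv1 Rintegral_set1 big_ord0.
rewrite big_ord_recr/= mulrSr addrA.
rewrite (@Rintegral_itv_chasles _ F a (a + w *+ n)); last 3 first.
- by rewrite lerDl mulrn_wge0.
- by rewrite lerDl.
- by move=> x _; exact: cF.
apply: lerD => //.
set p := a + w *+ n.
have -> : (F p + L * w) * w = (\int[mu]_(x in `[p, p + w]) (F p + L * w))%R.
  rewrite Rintegral_cst//=; congr (_ * _).
  rewrite lebesgue_measure_itv/= lte_fin ltrDl; case: ltP => w0'.
    by rewrite -EFinB/= addrAC subrr add0r.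
  by apply/eqP; rewrite eq_le w0'.
have L0 : 0 <= L.
  have := FL 1 0; rewrite subr0 normr1 mulr1; exact: le_trans.
apply: le_Rintegral => //.
- by apply: continuous_itv_integrable => x _; exact: cF.
- by apply: continuous_itv_integrable => x _; exact: cvg_cst.
- move=> x; rewrite /= in_itv/= => /andP[px xp].
  have h := FL x p; have h' := ler_norm (F x - F p).
  have : L * `|x - p| <= L * w.
    by rewrite ler_wpM2l// ger0_norm ?subr_ge0// lerBlDl.
  by lra.
Qed.

(** The bound is asked only for some arbitrarily large [n]. The caller may thus take [n] in a
    convenient arithmetic progression, or so large that an error term becomes negligible. *)
Lemma le_Rintegral_of_riemann_sums (F : R -> R) (L a b A : R) : a <= b ->
  (forall x y, `|F x - F y| <= L * `|x - y|) ->
  (forall eta (n0 : nat), 0 < eta -> exists n : nat, [/\ (n0 <= n)%N, (0 < n)%N &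
    (\sum_(j < n) F (a + (b - a) / n%:R *+ j)) * ((b - a) / n%:R) <= A + eta]) ->
  \int[mu]_(x in `[a, b]) F x <= A.
Proof.
move=> ab FL H; apply/ler_addgt0Pr => e e0.
have e2 : 0 < e / 2 by rewrite divr_gt0.
(* For [n] beyond this bound the Lipschitz error $L (b - a)^2 / n$ is at most $e / 2$. *)
have [n [nn n1 Hn]] := H _ (Num.bound (L * (b - a) ^+ 2 / (e / 2))) e2.
have nR : 0 < n%:R :> R by rewrite ltr0n.
pose w := (b - a) / n%:R.
have w0 : 0 <= w by rewrite /w divr_ge0 ?subr_ge0// ltW.
have bE : b = a + w *+ n.
  by rewrite /w -mulr_natr -mulrA mulVf ?gt_eqF// mulr1 addrC subrK.
have := le_Rintegral_riemann_sum a w0 FL n; rewrite -bE => /le_trans; apply.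
under eq_bigr do rewrite mulrDl.
rewrite big_split/= -mulr_suml sumr_const card_ord.
have -> : A + e = A + e / 2 + e / 2 by rewrite -addrA -splitr.
apply: lerD => //.
have -> : L * w * w *+ n = L * (b - a) ^+ 2 / n%:R.
  by rewrite /w -mulr_natr; field; rewrite gt_eqF.
rewrite ler_pdivrMr// -ler_pdivrMl// [leLHS]mulrC.
have x0 : 0 <= L * (b - a) ^+ 2 / (e / 2).
  have L0 : 0 <= L.
    have := FL 1 0; rewrite subr0 normr1 mulr1; exact: le_trans.
  by rewrite divr_ge0 ?(ltW e2)// mulr_ge0 ?sqr_ge0.
by rewrite (le_trans (ltW (archi_boundP x0)))// ler_nat.
Qed.

(** The mean value theorem for $x^{1-\alpha}$; the right-hand side telescopes when summed. The case
    $n = 0$ is separate, as $x^{1-\alpha}$ need not be differentiable at 0. *)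
Lemma powR_increment (n : nat) (alpha : R) : 0 <= alpha -> alpha < 1 ->
  (1 - alpha) * n.+1%:R `^ (- alpha) <= n.+1%:R `^ (1 - alpha) - n%:R `^ (1 - alpha).
Proof.
move=> a0 a1; case: n => [|n].
  by rewrite !powR1 powR0 ?subr_eq0 ?gt_eqF// mulr1 subr0 gerBl.
have dp (x : R) : x \in `[n.+1%:R, n.+2%:R] ->
    is_derive x 1 (fun x : R => x `^ (1 - alpha)) ((1 - alpha) * x `^ (1 - alpha - 1)).
  rewrite in_itv/= => /andP[nx _]; apply: is_derive1_powR.
  by rewrite (lt_le_trans _ nx)// ltr0n.
have cp : {within `[n.+1%:R, n.+2%:R], continuous (fun x : R => x `^ (1 - alpha))}.
  by apply: continuous_itv_within => x /dp/is_derive1_continuous.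
have nn : n.+1%:R <= n.+2%:R :> R by rewrite ler_nat.
have dp' (x : R) : x \in `]n.+1%:R, n.+2%:R[ ->
    is_derive x 1 (fun x : R => x `^ (1 - alpha)) ((1 - alpha) * x `^ (1 - alpha - 1)).
  by move=> h; apply: dp; exact: subset_itv_oo_cc h.
have [c + ->] := MVT_segment nn dp' cp.
rewrite in_itv/= => /andP[nc cn].
have c0 : 0 < c by rewrite (lt_le_trans _ nc)// ltr0n.
have -> : n.+2%:R - n.+1%:R = 1 :> R by rewrite -natrB// subSnn.
rewrite mulr1 ler_wpM2l ?subr_ge0 ?(ltW a1)//.
have -> : 1 - alpha - 1 = - alpha by ring.
exact: ge0_ler_powRN.
Qed.

Lemma sum_powRN_le (alpha : R) (n : nat) : 0 <= alpha -> alpha < 1 ->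
  \sum_(1 <= l < n.+1) l%:R `^ (- alpha) <= n%:R `^ (1 - alpha) / (1 - alpha).
Proof.
move=> a0 a1; have a10 : 0 < 1 - alpha by rewrite subr_gt0.
elim: n => [|n ih]; first by rewrite big_geq// divr_ge0 ?powR_ge0// ltW.
rewrite big_nat_recr//=; apply: le_trans (lerD ih (lexx _)) _.
have := powR_increment n a0 a1.
rewrite mulrC -ler_pdivlMr// mulrBl; lra.
Qed.

(** With truncated subtraction, [maxn (k - j) (j - k)] is $|k - j|$. Each distance $l \ge 1$ is
    attained at most once on either side of [j], whence the factor 2. *)
Lemma sum_dist_le (f : nat -> R) (n : nat) (j : 'I_n) : (forall l, 0 <= f l) ->
  \sum_(k < n | k != j) f (maxn (k - j) (j - k)) <= 2 * \sum_(1 <= l < n.+1) f l.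
Proof.
move=> f0; rewrite mulr2n mulrDl !mul1r.
rewrite (bigID (fun k : 'I_n => (k < j)%N))/=; apply: lerD.
- rewrite (eq_bigl (fun k : 'I_n => (k < j)%N)); last first.
    by move=> k; case: ltnP => kj; rewrite ?andbF// andbT -val_eqE/= (ltn_eqF kj).
  rewrite (eq_bigr (fun k : 'I_n => f (j - k)%N)); last first.
    by move=> k /ltnW; rewrite -subn_eq0 => /eqP ->; rewrite max0n.
  rewrite -(big_ord_widen _ (fun k => f (j - k)%N) (ltnW (ltn_ord j))).
  rewrite -(big_mkord xpredT (fun k => f (j - k)%N)) big_nat_rev/= add0n.
  rewrite (eq_big_nat _ _ (F2 := fun i => f i.+1)); last first.
    by move=> i /andP[_ ij]; congr f; rewrite subKn.
  rewrite -(big_add1 _ _ 0 j.+1 xpredT f).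
  rewrite [leRHS](big_cat_nat (n := j.+1))//=; last by rewrite ltnS ltnW.
  by rewrite lerDl sumr_ge0.
- rewrite (eq_bigl (fun k : 'I_n => (j < k)%N)); last first.
    by move=> k; rewrite -leqNgt -val_eqE/= eq_sym ltn_neqAle.
  rewrite (eq_bigr (fun k : 'I_n => f (k - j)%N)); last first.
    by move=> k /ltnW; rewrite -subn_eq0 => /eqP ->; rewrite maxn0.
  rewrite -(big_mkord (fun k => j < k)%N (fun k => f (k - j)%N)).
  rewrite (big_cat_nat (n := j.+1))//=.
  rewrite big_nat_cond big1 ?add0r; last by move=> i /andP[/andP[_ h1] h2]; move: h1; rewrite ltnS leqNgt h2.
  rewrite big_nat_cond (eq_bigl (fun i => (j.+1 <= i < n)%N && true)); last first.
    by move=> i; case: (ltnP j i).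
  rewrite -big_nat_cond -{1}(add0n j.+1) big_addn.
  rewrite (eq_bigr (fun i => f i.+1)); last by move=> i _; rewrite addnS subSn ?leq_addl// addnK.
  rewrite -(big_add1 _ _ 0 (n - j.+1).+1 xpredT f).
  rewrite [leRHS](big_cat_nat (n := (n - j.+1).+1))//=; last by rewrite ltnS leq_subr.
  by rewrite lerDl sumr_ge0.
Qed.

End Riemann_sums.

(** * The maximal inequality by $T T^*$, for an arbitrary set of parameters *)

Section maximal_TTstar.
Context {R : realType} {I : Type} (i0 : I).
Local Notation mu := (@lebesgue_measure R).
Variables (D : set R) (u v : R -> R) (P Q : R -> I -> R -> R).
Variables (L B A A0 alpha : R).
Hypotheses (mD : measurable D).
Hypotheses (su : square_integrable mu D u) (sv : square_integrable mu D v).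
Hypotheses (sP : forall x i, square_integrable mu D (P x i))
           (sQ : forall x i, square_integrable mu D (Q x i)).

Let T x i := pairing mu D u v (P x i) (Q x i).
Let K x i y j := pairing mu D (P x i) (Q x i) (P y j) (Q y j).

Hypothesis TL : forall x y i, `|T x i - T y i| <= L * `|x - y|.
Hypothesis TB : forall x i, `|T x i| <= B.
Hypotheses (A_ge0 : 0 <= A) (A0_ge0 : 0 <= A0).
Hypotheses (alpha_ge0 : 0 <= alpha) (alpha_lt1 : alpha < 1).
Hypothesis K0 : forall x i y j, `|K x i y j| <= A0.
Hypothesis KA : forall x i y j, x \in `[-1, 1] -> y \in `[-1, 1] -> x != y ->
  `|K x i y j| <= A * `|x - y| `^ (- alpha).

Definition maximal_square x : R := sup [set T x i ^+ 2 | i in [set: I]].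

Let ubT x : has_sup [set T x i ^+ 2 | i in [set: I]].
Proof.
split; first by exists (T x i0 ^+ 2), i0.
exists (B ^+ 2) => _ [i _ <-].
by rewrite -real_normK ?num_real// lerXn2r ?nnegrE// (le_trans _ (TB x i)).
Qed.

Lemma maximal_square_ge x i : T x i ^+ 2 <= maximal_square x.
Proof. by apply: ub_le_sup; [exact: (ubT x).2|exists i]. Qed.

Lemma maximal_square_ge0 x : 0 <= maximal_square x.
Proof. exact: le_trans (sqr_ge0 _) (maximal_square_ge x i0). Qed.

(** Factor the difference of squares for one index [i]; the bound does not depend on [i] and so
    passes to the supremum. *)
Lemma maximal_square_lipschitz x y :
  `|maximal_square x - maximal_square y| <= 2 * B * L * `|x - y|.
Proof.
have h x' y' : maximal_square x' <= maximal_square y' + 2 * B * L * `|x' - y'|.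
  apply: ge_sup; first by exists (T x' i0 ^+ 2), i0.
  move=> _ [i _ <-].
  apply: le_trans (lerD (maximal_square_ge y' i) (lexx _)).
  rewrite -lerBlDl subr_sqr mulrC.
  apply: le_trans (ler_norm _) _; rewrite normrM -(mulrA (2 * B)).
  apply: ler_pM => //.
  by apply: le_trans (ler_normD _ _) _; rewrite mulr2n mulrDl mul1r lerD.
by rewrite ler_norml lerBlDl h lerNl opprB lerBlDl distrC h.
Qed.

(** The diagonal entry costs [A0]. The others are sampled from $A |x - y|^{-\alpha}$ on a grid of
    step [d], and $\alpha < 1$ makes their sum grow only like $n^{1-\alpha}$. *)
Let row_sum (n : nat) (x : 'I_n -> R) (i : 'I_n -> I) (d : R) : (0 < n)%N -> 0 < d ->
  (forall j, x j \in `[-1, 1]) ->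
  (forall j k : 'I_n, `|x j - x k| = d * (maxn (k - j) (j - k))%:R) ->
  forall j, \sum_k `|K (x j) (i j) (x k) (i k)| <=
    A0 + A * (2 * (d `^ (- alpha) * (n%:R `^ (1 - alpha) / (1 - alpha)))).
Proof.
move=> n0 d0 x1 xd j; rewrite (bigD1 j)//=; apply: lerD => //.
apply: (@le_trans _ _ (\sum_(k < n | k != j) A * (d `^ (- alpha) * (maxn (k - j) (j - k))%:R `^ (- alpha)))).
  apply: ler_sum => k kj.
  have xjk : x j != x k.
    rewrite -subr_eq0 -normr_eq0 xd mulf_neq0 ?(gt_eqF d0)// pnatr_eq0 -lt0n leq_max !subn_gt0.
    by rewrite -neq_ltn eq_sym; exact: kj.
  apply: le_trans (KA _ _ _ _ xjk) _ => //.
  by rewrite xd powRM// ltW.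
rewrite -mulr_sumr ler_wpM2l// -mulr_sumr mulrCA ler_wpM2l ?powR_ge0//.
apply: le_trans (@sum_dist_le _ (fun l => l%:R `^ (- alpha)) _ _ _) _.
  by move=> l; exact: powR_ge0.
by rewrite ler_wpM2l// sum_powRN_le.
Qed.

(** On the grid of step $d = 2 / n$ the row sums of the Gram matrix are multiplied by $d$. The
    diagonal, where the kernel is singular, contributes $A_0 d \to 0$; the rest contributes a
    multiple of $A d^{1-\alpha} n^{1-\alpha} = A\, 2^{1-\alpha}$, uniformly in $n$. *)
Lemma maximal_square_integral :
  (\int[mu]_(x in `[-1, 1]) maximal_square x <=
    4 * A / (1 - alpha) * pairing mu D u v u v)%R.
Proof.
have a10 : 0 < 1 - alpha by rewrite subr_gt0.
set E := pairing mu D u v u v.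
have E0 : 0 <= E by apply: Rintegral_ge0 => x _; rewrite addr_ge0 -?expr2 ?sqr_ge0.
apply: (le_Rintegral_of_riemann_sums _ maximal_square_lipschitz); first by lra.
move=> eta n1 eta0.
(* Makes the diagonal contribution $2 (A_0 + 1) E / n$ at most $\eta / 2$. *)
pose nb := Num.bound ((2 * (A0 + 1) * E) / (eta / 2)).
pose n := maxn n1 (maxn nb 1).
have nbn : (nb <= n)%N by rewrite /n !leq_max leqnn orbT.
have n0 : (0 < n)%N by rewrite /n !leq_max leqnn !orbT.
exists n; split => //; first by rewrite /n leq_max leqnn.
have nR : 0 < n%:R :> R by rewrite ltr0n.
have -> : 1 - (-1) = 2 :> R by ring.
pose d : R := 2 / n%:R; rewrite -/d.
have d0 : 0 < d by rewrite divr_gt0.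
have dn : d *+ n = 2 by rewrite -(mulr_natr d) /d divfK ?gt_eqF//.
pose x (j : 'I_n) := -1 + d *+ j.
have x1 j : x j \in `[-1, 1].
  rewrite in_itv/= lerDl mulrn_wge0 ?(ltW d0)//= /x.
  have : d *+ j <= d *+ n by rewrite -!(mulr_natr d) ler_pM2l// ler_nat ltnW.
  by rewrite dn; lra.
have xd (j k : 'I_n) : `|x j - x k| = d * (maxn (k - j) (j - k))%:R.
  rewrite /x opprD addrACA subrr add0r.
  wlog jk : j k / (k <= j)%N.
    by move=> W; case/orP: (leq_total j k) => h; [rewrite distrC maxnC|]; exact: W.
  rewrite -mulrnBr// ger0_norm ?mulrn_wge0 ?(ltW d0)//.
  by move: (jk); rewrite -subn_eq0 => /eqP ->; rewrite max0n mulr_natr.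
(* Only finitely many indices are chosen, one for each grid point. The loss $\eta / 4$ at each of
   them amounts to $\eta / 2$ in the sum, since $n d = 2$. *)
have /choice[i iP] : forall j, exists i, maximal_square (x j) - eta / 4 < T (x j) i ^+ 2.
  move=> j.
  have [_ [i _ <-] ih] := @sup_adherent _ _ (eta / 4) (divr_gt0 eta0 (ltr0n _ 4)) (ubT (x j)).
  by exists i.
(* The summand 1 makes [M] positive even if [A0] and [A] vanish. *)
pose M := A0 + 1 + A * (2 * (d `^ (- alpha) * (n%:R `^ (1 - alpha) / (1 - alpha)))).
have M0 : 0 < M.
  rewrite /M ltr_wpDr ?ltr_wpDl// mulr_ge0// mulr_ge0// mulr_ge0 ?powR_ge0//.
  by rewrite divr_ge0 ?powR_ge0// ltW.
have bes : \sum_j T (x j) (i j) ^+ 2 <= M * E.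
  apply: (@bessel_almost_orthogonal _ _ _ mu D mD n (fun j => P (x j) (i j)) (fun j => Q (x j) (i j))) => //.
  move=> j; apply: le_trans (row_sum i n0 d0 x1 xd j) _.
  by rewrite /M lerD2r lerDl.
have s1 : \sum_(j < n) maximal_square (x j) <= M * E + n%:R * (eta / 4).
  apply: (@le_trans _ _ (\sum_(j < n) (T (x j) (i j) ^+ 2 + eta / 4))).
    by apply: ler_sum => j _; rewrite -lerBlDr ltW.
  by rewrite big_split/= sumr_const card_ord mulr_natl lerD2r.
apply: (@le_trans _ _ ((M * E + n%:R * (eta / 4)) * d)).
  by rewrite ler_wpM2r// ltW.
have dE : n%:R * (eta / 4) * d = eta / 2 by rewrite /d; field; rewrite gt_eqF.
have pd : d `^ (- alpha) * n%:R `^ (1 - alpha) * d <= 2.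
  have -> : d `^ (- alpha) * n%:R `^ (1 - alpha) * d = 2 `^ (1 - alpha).
    rewrite mulrAC -{2}(powRr1 (ltW d0)) -powRD; last by rewrite (gt_eqF d0) implybT.
    rewrite addrC -powRM ?ltW//; congr (_ `^ _).
    by rewrite mulr_natr dn.
  have : 2 `^ (1 - alpha) <= 2 `^ 1 :> R.
    by rewrite ler_powR// ?ler1n// lerBlDr lerDl.
  by rewrite powRr1.
have Md : M * d <= 2 * (A0 + 1) / n%:R + 4 * A / (1 - alpha).
  rewrite /M mulrDl; apply: lerD.
    by rewrite /d mulrCA mulrA.
  rewrite [leLHS](_ : _ = 2 * A / (1 - alpha) * (d `^ (- alpha) * n%:R `^ (1 - alpha) * d)); last first.
    by move: (d `^ _) (n%:R `^ _) => a b; field; rewrite gt_eqF.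
  have -> : 4 * A / (1 - alpha) = 2 * A / (1 - alpha) * 2 by ring.
  by rewrite ler_wpM2l// divr_ge0 ?mulr_ge0// ltW.
have nE : 2 * (A0 + 1) / n%:R * E <= eta / 2.
  rewrite mulrAC ler_pdivrMr// -ler_pdivrMl ?divr_gt0// mulrC.
  have X0 : 0 <= 2 * (A0 + 1) * E / (eta / 2).
    by rewrite divr_ge0 ?mulr_ge0 ?addr_ge0 ?divr_ge0 ?(ltW eta0).
  by rewrite (le_trans (ltW (archi_boundP X0)))// ler_nat.
have := ler_wpM2r E0 Md; rewrite [leRHS]mulrDl => h.
rewrite mulrDl dE (_ : M * E * d = M * d * E); last by ring.
apply: le_trans (lerD h (lexx _)) _.
apply: le_trans (lerD (lerD nE (lexx _)) (lexx _)) _.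
by rewrite (addrC (eta / 2)) -addrA -splitr.
Qed.

Lemma exists_maximal_square : exists Phi : R -> R,
  [/\ continuous Phi, forall x, 0 <= Phi x,
      forall x i, pairing mu D u v (P x i) (Q x i) ^+ 2 <= Phi x &
      (\int[mu]_(x in `[-1, 1]) Phi x <=
        4 * A / (1 - alpha) * pairing mu D u v u v)%R].
Proof.
exists maximal_square; split.
- exact: lipschitz_continuous maximal_square_lipschitz.
- exact: maximal_square_ge0.
- exact: maximal_square_ge.
- exact: maximal_square_integral.
Qed.

End maximal_TTstar.

(** * Oscillatory integrals over annuli as $L^2$ pairings *)

Section oscillatory_integrals.
Context {R : realType}.
Local Notation mu := (@lebesgue_measure R).
Implicit Types (D E : set R) (phi psi u v : R -> R).

Lemma MVT_lipschitz1 (f f' : R -> R) : (forall x : R, is_derive x 1 f (f' x)) ->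
  (forall x, `|f' x| <= 1) -> forall x y, `|f x - f y| <= `|x - y|.
Proof.
move=> df f1 x y; wlog xy : x y / x <= y.
  move=> W; case/orP: (le_total x y) => h; first exact: W.
  by rewrite distrC (distrC x); exact: W.
have cf : {within `[x, y], continuous f}.
  by apply: continuous_itv_within => z _; exact: is_derive1_continuous (df z).
have [c _ E] := MVT_segment xy (fun z _ => df z) cf.
by rewrite distrC (distrC x) E normrM ler_piMl.
Qed.

Lemma cos_lipschitz (x y : R) : `|cos x - cos y| <= `|x - y|.
Proof.
apply: (@MVT_lipschitz1 cos (fun x => - sin x)) => z.
by rewrite normrN ler_norml sin_geN1 sin_le1.
Qed.

Lemma sin_lipschitz (x y : R) : `|sin x - sin y| <= `|x - y|.
Proof.
apply: (@MVT_lipschitz1 sin cos) => z.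
by rewrite ler_norml cos_geN1 cos_le1.
Qed.

Lemma norm_cos_le1 (x : R) : `|cos x| <= 1.
Proof. by rewrite ler_norml cos_geN1 cos_le1. Qed.

Lemma norm_sin_le1 (x : R) : `|sin x| <= 1.
Proof. by rewrite ler_norml sin_geN1 sin_le1. Qed.

Lemma measurable_cos_comp D phi : measurable_fun D phi ->
  measurable_fun D (fun x => cos (phi x)).
Proof.
by move=> mphi; apply: measurableT_comp => //; apply: continuous_measurable_fun; exact: continuous_cos.
Qed.

Lemma measurable_sin_comp D phi : measurable_fun D phi ->
  measurable_fun D (fun x => sin (phi x)).
Proof.
by move=> mphi; apply: measurableT_comp => //; apply: continuous_measurable_fun; exact: continuous_sin.
Qed.

Lemma Rintegral_indicM D E f : E `<=` D ->
  (\int[mu]_(x in D) (\1_E x * f x) = \int[mu]_(x in E) f x)%R.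
Proof.
move=> ED; rewrite -[in RHS](setIidr ED) Rintegral_mkcondr.
apply: eq_Rintegral => x _; rewrite patchE indicE.
by case: (x \in E); rewrite ?mul1r ?mul0r.
Qed.

Lemma square_integrable_abs D u : measurable D -> (mu D < +oo)%E ->
  square_integrable mu D u -> mu.-integrable D (EFin \o (fun x => `|u x|)).
Proof.
move=> mD Doo su.
have s1 : square_integrable mu D (cst 1).
  by apply: (bounded_square_integrable mu mD 1) => // x _; rewrite normr1.
have iu : mu.-integrable D (EFin \o u).
  rewrite (_ : u = (fun x => u x * cst 1 x)); last first.
    by apply/funext => x; rewrite /= mulr1.
  exact: (square_integrable_mul mu).
exact: integrable_norm.
Qed.

Lemma le_norm_pairing D u v p q c : measurable D -> (mu D < +oo)%E ->
  square_integrable mu D u -> square_integrable mu D v ->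
  square_integrable mu D p -> square_integrable mu D q ->
  (forall x, D x -> `|p x| <= c) -> (forall x, D x -> `|q x| <= c) ->
  `|pairing mu D u v p q| <= c * (\int[mu]_(x in D) (`|u x| + `|v x|))%R.
Proof.
move=> mD Doo su sv sp sq pc qc.
have iuv : mu.-integrable D (EFin \o (fun x => `|u x| + `|v x|)).
  by apply: (integrable_EFinD mu) => //; exact: square_integrable_abs.
have ip := pairing_integrable mu mD su sv sp sq.
rewrite /pairing; apply: (le_trans (le_normr_Rintegral _ ip)) => //.
rewrite -RintegralZl//; apply: le_Rintegral => //.
- exact: integrable_norm.
- exact: (integrable_EFinZ mu).
- move=> x Dx; apply: (le_trans (ler_normD _ _)); rewrite !normrM mulrDr.
  by rewrite !(mulrC c) lerD// ler_wpM2l// ?pc ?qc.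
Qed.

Lemma pairingBr D u v p q p' q' : measurable D ->
  square_integrable mu D u -> square_integrable mu D v ->
  square_integrable mu D p -> square_integrable mu D q ->
  square_integrable mu D p' -> square_integrable mu D q' ->
  pairing mu D u v p q - pairing mu D u v p' q' =
  pairing mu D u v (fun x => p x - p' x) (fun x => q x - q' x).
Proof.
move=> mD su sv sp sq sp' sq'.
rewrite /pairing -RintegralB//; [|exact: (pairing_integrable mu)|exact: (pairing_integrable mu)].
by apply: eq_Rintegral => x _; ring.
Qed.

(** The real part of $\int_E (u + i v) e^{i \phi}$; the imaginary part is [osc E phi v (- u)]. *)
Definition osc E phi u v : R :=
  (\int[mu]_(x in E) (u x * cos (phi x) - v x * sin (phi x)))%R.

(** The components of $1_E e^{-i \phi}$. Putting the truncation into the vector lets all truncations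
    act on one and the same space $L^2(D)$. *)
Definition osc_cos E phi : R -> R := fun x => \1_E x * cos (phi x).
Definition osc_sin E phi : R -> R := fun x => \1_E x * - sin (phi x).

Lemma norm_indicM_le1 E (a x : R) : `|a| <= 1 -> `|\1_E x * a| <= 1.
Proof.
by move=> a1; rewrite indicE; case: (x \in E); rewrite ?mul1r// mul0r normr0.
Qed.

Lemma square_integrable_osc D E phi : measurable D -> (mu D < +oo)%E ->
  measurable E -> measurable_fun D phi ->
  square_integrable mu D (osc_cos E phi) /\ square_integrable mu D (osc_sin E phi).
Proof.
move=> mD Doo mE mphi; split.
- apply: (bounded_square_integrable mu mD 1) => //.
    apply: measurable_funM; first exact: measurable_indic.
    exact: measurable_cos_comp.
  by move=> x _; apply: norm_indicM_le1; exact: norm_cos_le1.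
- apply: (bounded_square_integrable mu mD 1) => //.
    apply: measurable_funM; first exact: measurable_indic.
    by apply: measurableT_comp => //; exact: measurable_sin_comp.
  by move=> x _; apply: norm_indicM_le1; rewrite normrN; exact: norm_sin_le1.
Qed.

Lemma pairing_osc D E phi u v : E `<=` D ->
  pairing mu D u v (osc_cos E phi) (osc_sin E phi) = osc E phi u v.
Proof.
move=> ED; rewrite /osc -(Rintegral_indicM _ ED).
by apply: eq_Rintegral => x _; rewrite /osc_cos /osc_sin; ring.
Qed.

(** The kernel of $T T^*$ is again an oscillatory integral: truncations intersect and phases are
    subtracted. *)
Lemma pairing_osc_osc D E E' phi psi : E `<=` D ->
  pairing mu D (osc_cos E phi) (osc_sin E phi) (osc_cos E' psi) (osc_sin E' psi) =
  (\int[mu]_(x in E `&` E') cos (phi x - psi x))%R.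
Proof.
move=> ED; have EE'D : E `&` E' `<=` D by move=> x [/ED].
rewrite -(Rintegral_indicM _ EE'D).
apply: eq_Rintegral => x _; rewrite /osc_cos /osc_sin cosB indicI/=; ring.
Qed.

Lemma osc_lipschitz D E phi psi u v c : measurable D -> (mu D < +oo)%E ->
  measurable E -> E `<=` D -> measurable_fun D phi -> measurable_fun D psi ->
  square_integrable mu D u -> square_integrable mu D v -> 0 <= c ->
  (forall x, E x -> `|phi x - psi x| <= c) ->
  `|osc E phi u v - osc E psi u v| <= c * (\int[mu]_(x in D) (`|u x| + `|v x|))%R.
Proof.
move=> mD Doo mE ED mphi mpsi su sv c0 pc.
have [s1 s2] := square_integrable_osc mD Doo mE mphi.
have [s3 s4] := square_integrable_osc mD Doo mE mpsi.
rewrite -!(pairing_osc _ _ _ ED) pairingBr//.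
apply: le_norm_pairing => //; try exact: (square_integrableB mu).
- move=> x Dx; rewrite /osc_cos -mulrBr indicE.
  case: (boolP (x \in E)) => [|_]; last by rewrite mul0r normr0.
  by rewrite inE mul1r => Ex; rewrite (le_trans (cos_lipschitz _ _))// pc.
- move=> x Dx; rewrite /osc_sin -mulrBr indicE.
  case: (boolP (x \in E)) => [|_]; last by rewrite mul0r normr0.
  rewrite inE mul1r => Ex; rewrite -opprD normrN.
  by rewrite (le_trans (sin_lipschitz _ _))// pc.
Qed.

Lemma le_norm_osc D E phi u v : measurable D -> (mu D < +oo)%E ->
  measurable E -> E `<=` D -> measurable_fun D phi ->
  square_integrable mu D u -> square_integrable mu D v ->
  `|osc E phi u v| <= (\int[mu]_(x in D) (`|u x| + `|v x|))%R.
Proof.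
move=> mD Doo mE ED mphi su sv.
have [s1 s2] := square_integrable_osc mD Doo mE mphi.
rewrite -(pairing_osc _ _ _ ED) -[leRHS]mul1r.
apply: le_norm_pairing => //.
- by move=> x _; apply: norm_indicM_le1; exact: norm_cos_le1.
- by move=> x _; apply: norm_indicM_le1; rewrite normrN; exact: norm_sin_le1.
Qed.

(** Open inside and closed outside, so that it is exactly $[-q, q]$ without $[-r, r]$ and
    consecutive annuli are disjoint. *)
Definition annulus (r q : R) : set R := [set x | r < `|x| <= q].

Lemma annulusE r q : 0 <= r -> annulus r q = `[- q, - r[ `|` `]r, q].
Proof.
move=> r0; apply/seteqP; split => x; rewrite /annulus/= !in_itv/=.
- move=> /andP[rx xq]; case: (leP 0 x) => x0.
    by right; move: rx xq; rewrite ger0_norm// => -> ->.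
  by left; move: rx xq; rewrite ltr0_norm// lerNl ltrNr => -> ->.
- move=> [/andP[qx xr]|/andP[rx xq]].
    have x0 : x < 0 by rewrite (lt_le_trans xr)// oppr_le0.
    by rewrite ltr0_norm// ltrNr xr lerNl qx.
  by rewrite gtr0_norm ?(le_lt_trans r0)// rx xq.
Qed.

Lemma measurable_annulus r q : 0 <= r -> measurable (annulus r q).
Proof. by move=> r0; rewrite annulusE//; exact: measurableU. Qed.

Lemma annulus_sub_itv r q : annulus r q `<=` `[- q, q].
Proof. by move=> x /= /andP[_]; rewrite in_itv/= ler_norml. Qed.

Lemma annulus_subr r q q' : q <= q' -> annulus r q `<=` annulus r q'.
Proof. by move=> qq x; rewrite /annulus/= => /andP[-> xq]; exact: le_trans qq. Qed.

Lemma annulusI r q q' : annulus r q `&` annulus r q' = annulus r (Num.min q q').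
Proof.
apply/seteqP; split => x; rewrite /annulus/= le_min.
  by move=> [/andP[-> ->] /andP[_ ->]].
by move=> /and3P[-> -> ->].
Qed.

Lemma annulus_measure_lty r q : 0 <= r -> (mu (annulus r q) < +oo)%E.
Proof.
move=> r0; apply: (@le_lt_trans _ _ (mu `[- q, q])).
  by apply: le_measure; rewrite ?inE//; [exact: measurable_annulus|exact: annulus_sub_itv].
by rewrite lebesgue_measure_itv/=; case: ifP => _; rewrite ?ltry// -EFinB ltry.
Qed.

Lemma Rintegral_annulus (f : R -> R) r q : 0 < r -> r <= q ->
  (forall x, x \in `[r, q] -> {for x, continuous f}) ->
  (forall x, x \in `[- q, - r] -> {for x, continuous f}) ->
  (\int[mu]_(x in annulus r q) f x =
   \int[mu]_(x in `[r, q]) f (- x) + \int[mu]_(x in `[r, q]) f x)%R.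
Proof.
move=> r0 rq cf cf'.
have i1 := continuous_itv_integrable cf.
have i2 := continuous_itv_integrable cf'.
have i1' : mu.-integrable `]r, q] (EFin \o f).
  by apply: integrableS i1 => //; apply: subset_itv; rewrite bnd_simp.
have i2' : mu.-integrable `[- q, - r[ (EFin \o f).
  by apply: integrableS i2 => //; apply: subset_itv; rewrite bnd_simp.
have dis : `[- q, - r[ `&` `]r, q] = set0.
  apply/seteqP; split => x //=; rewrite !in_itv/= => -[/andP[_ h1] /andP[h2 _]].
  by move: (lt_trans h2 h1); rewrite ltNge lerNl/=; lra.
have mf : measurable_fun (`[- q, - r[ `|` `]r, q]) f.
  apply/measurable_funU => //; split.
  - by case/integrableP: i2' => /measurable_EFinP.
  - by case/integrableP: i1' => /measurable_EFinP.
rewrite annulusE ?ltW// Rintegral_setU//; last 2 first.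
- apply/integrableP; split; first exact/measurable_EFinP.
  rewrite ge0_integral_setU//=; last 2 first.
  + by apply/measurable_EFinP; exact: measurableT_comp.
  + exact/disj_set2P.
  by apply: lte_add_pinfty; [case/integrableP: i2'|case/integrableP: i1'].
- exact/disj_set2P.
congr (_ + _); last by rewrite Rintegral_itv_obnd_cbnd.
rewrite Rintegral_itv_bndo_bndc//.
by rewrite /Rintegral integration_by_substitution_oppr//; exact: continuous_itv_within.
Qed.

End oscillatory_integrals.

(** * The maximal bound for one frequency annulus along the curves *)

Section block_maximal.
Context {R : realType}.
Local Notation mu := (@lebesgue_measure R).
Variables (m kappa C1 C2 : R) (gamma : R -> R -> R).
Hypotheses (m1 : 1 < m) (kappa0 : 0 < kappa) (C10 : 0 < C1) (C20 : 0 < C2).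
Hypothesis gamma_t : forall x t t', t \in `[-1, 1] -> t' \in `[-1, 1] ->
  `|gamma x t - gamma x t'| <= C1 * `|t - t'| `^ kappa.
Hypothesis gamma_x : forall t x x', t \in `[-1, 1] ->
  C2^-1 * `|x - x'| <= `|gamma x t - gamma x' t| <= C2 * `|x - x'|.

Definition schrodinger_phase (a b xi : R) : R := a * xi + b * `|xi| `^ m.

Lemma measurable_schrodinger_phase (D : set R) a b :
  measurable_fun D (schrodinger_phase a b).
Proof.
apply: measurable_funTS; apply: measurable_funD; apply: measurable_funM => //.
by rewrite (_ : (fun x => _) = (@powR R ^~ m) \o Num.norm)//; apply: measurableT_comp.
Qed.

Lemma continuous_schrodinger_phase a b (x : R) : x != 0 ->
  {for x, continuous (schrodinger_phase a b)}.
Proof.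
move=> x0; apply: cvgD; apply: cvgM; try exact: cvg_cst; first exact: cvg_id.
have n0 : 0 < `|x| by rewrite normr_gt0.
apply: (continuous_comp (g := fun y : R => y `^ m)); first exact: norm_continuous.
exact: is_derive1_continuous (is_derive1_powR m n0).
Qed.

Lemma Rintegral_annulus_cos lam q a b : 0 < lam -> lam <= q ->
  (\int[mu]_(x in annulus lam q) cos (schrodinger_phase a b x) =
   cos_phase m lam q (- a) b + cos_phase m lam q a b)%R.
Proof.
move=> lam0 lamq; have q0 : 0 < q by exact: lt_le_trans lamq.
have c1 x : x \in `[lam, q] -> {for x, continuous (fun x => cos (schrodinger_phase a b x))}.
  rewrite in_itv/= => /andP[lx _].
  apply: (continuous_comp (g := cos)); last exact: continuous_cos.
  by apply: continuous_schrodinger_phase; rewrite gt_eqF// (lt_le_trans lam0).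
have c2 x : x \in `[- q, - lam] -> {for x, continuous (fun x => cos (schrodinger_phase a b x))}.
  rewrite in_itv/= => /andP[_ lx].
  apply: (continuous_comp (g := cos)); last exact: continuous_cos.
  apply: continuous_schrodinger_phase; rewrite lt_eqF// (le_lt_trans lx)//.
  by rewrite oppr_lt0.
apply: (etrans (Rintegral_annulus lam0 lamq c1 c2)).
have -> : (\int[mu]_(x in `[lam, q]) cos (schrodinger_phase a b (- x)) =
    cos_phase m lam q (- a) b)%R.
  apply: eq_Rintegral => x; rewrite inE/= in_itv/= => /andP[lx _].
  rewrite /schrodinger_phase normrN ger0_norm ?mulrN ?mulNr//.
  by rewrite (le_trans (ltW lam0)).
have -> // : (\int[mu]_(x in `[lam, q]) cos (schrodinger_phase a b x) =
    cos_phase m lam q a b)%R.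
apply: eq_Rintegral => x; rewrite inE/= in_itv/= => /andP[lx _].
by rewrite /schrodinger_phase ger0_norm// (le_trans (ltW lam0)).
Qed.

Lemma itv11_dist_le2 (x y : R) : x \in `[-1, 1] -> y \in `[-1, 1] -> `|x - y| <= 2.
Proof.
rewrite !in_itv/= => /andP[x1 x2] /andP[y1 y2].
by rewrite ler_norml; apply/andP; split; lra.
Qed.

(** Pass through $\gamma(y, t)$: at equal times the points are at least $D / C_2$ apart, and moving
    from $t$ to $t'$ at fixed $y$ costs at most $C_1 |t - t'|^\kappa$. *)
Lemma gamma_separation x y t t' : t \in `[-1, 1] -> t' \in `[-1, 1] ->
  `|x - y| / C2 - C1 * `|t - t'| `^ kappa <= `|gamma x t - gamma y t'|.
Proof.
move=> ht ht'.
have /andP[h1 _] := gamma_x x y ht.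
have h2 := gamma_t y ht ht'.
have h3 := ler_distD (gamma y t') (gamma x t) (gamma y t).
rewrite (distrC (gamma y t')) in h3; rewrite mulrC; lra.
Qed.

Lemma block_maximal (theta sigma alpha : R) :
  0 <= theta -> theta <= 1 -> 1 - theta * m / 2 <= 2 * sigma ->
  theta / (2 * kappa) <= alpha -> 2^-1 <= alpha -> 2^-1 <= 2 * sigma -> alpha < 1 ->
  exists C : R, 0 <= C /\ forall (lam : R) (u v : R -> R), 1 <= lam ->
    let D := annulus lam (2 * lam) in
    square_integrable mu D u -> square_integrable mu D v ->
    exists Phi : R -> R,
      [/\ continuous Phi, forall x, 0 <= Phi x,
        forall x t (N : nat), t \in `[-1, 1] -> lam <= N%:R -> N%:R <= 2 * lam ->
          osc (annulus lam N%:R) (schrodinger_phase (gamma x t) t) u v ^+ 2 <= Phi x &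
        (\int[mu]_(x in `[-1, 1]) Phi x <=
          C * lam `^ (2 * sigma) * pairing mu D u v u v)%R].
Proof.
move=> th0 th1 hsig htk ha hs a1.
have [Ck [Ck0 HC]] := dispersive_kernel_bound m1 kappa0 C10 C20 th0 th1 hsig htk ha hs.
have a10 : 0 < 1 - alpha by rewrite subr_gt0.
have a0 : 0 <= alpha by apply: le_trans ha; rewrite invr_ge0.
exists (4 * (2 * Ck) / (1 - alpha)); split.
  by rewrite divr_ge0 ?mulr_ge0// ltW.
move=> lam u v lam1 D su sv.
have lam0 : 0 < lam by exact: lt_le_trans lam1.
have mA q : measurable (annulus lam q) by apply: measurable_annulus; exact: ltW.
have mD : measurable D by exact: mA.
have Doo : (mu D < +oo)%E by apply: annulus_measure_lty; exact: ltW.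
pose I := {p : R * nat | [&& p.1 \in `[-1, 1], lam <= p.2%:R & p.2%:R <= 2 * lam]}.
(* A real supremum needs an index. If no integer lies in $[\lambda, 2\lambda]$, nothing is to be
   bounded and $\Phi = 0$ will do. *)
have [[N0 [l0 N02]]|noN] := pselect (exists N : nat, lam <= N%:R /\ N%:R <= 2 * lam); last first.
  exists (cst 0); split => //.
  - by move=> x; exact: cvg_cst.
  - by move=> x t N _ h1 h2; exfalso; apply: noN; exists N.
  - rewrite Rintegral_cst// mul0r !mulr_ge0 ?powR_ge0 ?invr_ge0 ?(ltW a10)//.
    by apply: Rintegral_ge0 => x _; rewrite addr_ge0 -?expr2 ?sqr_ge0.
have i0P : [&& (0 : R, N0).1 \in `[-1, 1], lam <= (0 : R, N0).2%:R & (0 : R, N0).2%:R <= 2 * lam].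
  by rewrite /= in_itv/= lerN10 ler01 l0.
pose i0 : I := exist _ (0, N0) i0P.
pose E (i : I) : set R := annulus lam (sval i).2%:R.
pose phi x (i : I) := schrodinger_phase (gamma x (sval i).1) (sval i).1.
pose G := (\int[mu]_(x in D) (`|u x| + `|v x|))%R.
have G0 : 0 <= G by apply: Rintegral_ge0 => x _; rewrite addr_ge0.
have iP (i : I) : [/\ (sval i).1 \in `[-1, 1], lam <= (sval i).2%:R & (sval i).2%:R <= 2 * lam].
  by case: i => /= p /and3P[].
have ED i : E i `<=` D by apply: annulus_subr; have [] := iP i.
have mphi x i : measurable_fun D (phi x i) by exact: measurable_schrodinger_phase.
have oscE x i : pairing mu D u v (osc_cos (E i) (phi x i)) (osc_sin (E i) (phi x i)) =
    osc (E i) (phi x i) u v by exact: pairing_osc.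
(* Annuli with the same inner radius meet in the one with the smaller outer radius. The two terms
   are the negative and the positive frequencies, and account for the factor 2 in the constant. *)
have KE x i y j : exists q, [/\ lam <= q, q <= 2 * lam &
    pairing mu D (osc_cos (E i) (phi x i)) (osc_sin (E i) (phi x i))
                (osc_cos (E j) (phi y j)) (osc_sin (E j) (phi y j)) =
    cos_phase m lam q (- (gamma x (sval i).1 - gamma y (sval j).1)) ((sval i).1 - (sval j).1) +
    cos_phase m lam q (gamma x (sval i).1 - gamma y (sval j).1) ((sval i).1 - (sval j).1)].
  have [_ i1 i2] := iP i; have [_ j1 j2] := iP j.
  exists (Num.min (sval i).2%:R (sval j).2%:R); split.
  - by rewrite le_min i1 j1.
  - by rewrite ge_min i2.
  - rewrite pairing_osc_osc// annulusI -Rintegral_annulus_cos ?le_min ?i1//.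
    apply: eq_Rintegral => xi _; congr cos.
    rewrite /phi /schrodinger_phase; ring.
have TL x y i : `|pairing mu D u v (osc_cos (E i) (phi x i)) (osc_sin (E i) (phi x i)) -
    pairing mu D u v (osc_cos (E i) (phi y i)) (osc_sin (E i) (phi y i))| <=
    (C2 * (2 * lam) * G) * `|x - y|.
  rewrite !oscE.
  (* The index is the same on both sides, so the terms in [t] cancel and the phases differ by
     $(\gamma(x, t) - \gamma(y, t)) \xi$ with $|\xi| \le 2\lambda$. *)
  have c0 : 0 <= C2 * `|x - y| * (2 * lam) by rewrite !mulr_ge0// ltW.
  rewrite [leRHS](_ : _ = C2 * `|x - y| * (2 * lam) * G); last by ring.
  apply: osc_lipschitz => //; first exact: mA.
  move=> xi; rewrite /E/annulus/= => /andP[_ xiN].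
  have [it _ iN] := iP i.
  rewrite /phi /schrodinger_phase opprD addrACA subrr addr0 -mulrBl normrM.
  rewrite ler_pM// ?(le_trans xiN)//.
  by have /andP[] := gamma_x x y it.
have TB x i : `|pairing mu D u v (osc_cos (E i) (phi x i)) (osc_sin (E i) (phi x i))| <= G.
  rewrite oscE; apply: le_norm_osc => //; exact: mA.
have A_ge0 : 0 <= 2 * (Ck * lam `^ (2 * sigma)) by rewrite !mulr_ge0 ?powR_ge0.
have A0_ge0 : 0 <= 2 * lam by rewrite mulr_ge0// ltW.
have sP x i : square_integrable mu D (osc_cos (E i) (phi x i)).
  by apply: (square_integrable_osc mD Doo (mA _) (mphi x i)).1.
have sQ x i : square_integrable mu D (osc_sin (E i) (phi x i)).
  by apply: (square_integrable_osc mD Doo (mA _) (mphi x i)).2.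
have K0 x i y j : `|pairing mu D (osc_cos (E i) (phi x i)) (osc_sin (E i) (phi x i))
                (osc_cos (E j) (phi y j)) (osc_sin (E j) (phi y j))| <= 2 * lam.
  have [q [q1 q2 ->]] := KE x i y j.
  apply: le_trans (ler_normD _ _) _.
  apply: le_trans (lerD (cos_phase_trivial m lam0 q1 q2 _ _) (cos_phase_trivial m lam0 q1 q2 _ _)) _.
  by rewrite -mulr2n mulr_natl.
have KA x i y j : x \in `[-1, 1] -> y \in `[-1, 1] -> x != y ->
    `|pairing mu D (osc_cos (E i) (phi x i)) (osc_sin (E i) (phi x i))
                (osc_cos (E j) (phi y j)) (osc_sin (E j) (phi y j))| <=
    2 * (Ck * lam `^ (2 * sigma)) * `|x - y| `^ (- alpha).
  move=> x11 y11 xy; have xy2 := itv11_dist_le2 x11 y11.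
  have [q [q1 q2 ->]] := KE x i y j.
  have xy0 : 0 < `|x - y| by rewrite normr_gt0 subr_eq0.

  have [it _ _] := iP i; have [jt _ _] := iP j.
  have sep := gamma_separation x y it jt.
  have h1 := HC _ _ (gamma x (sval i).1 - gamma y (sval j).1) ((sval i).1 - (sval j).1)
     _ lam1 q1 q2 xy0 xy2 sep.
  have sep' : `|x - y| / C2 - C1 * `|(sval i).1 - (sval j).1| `^ kappa <=
      `|- (gamma x (sval i).1 - gamma y (sval j).1)| by rewrite normrN.
  have h2 := HC _ _ (- (gamma x (sval i).1 - gamma y (sval j).1)) ((sval i).1 - (sval j).1)
     _ lam1 q1 q2 xy0 xy2 sep'.
  apply: le_trans (ler_normD _ _) _.
  apply: le_trans (lerD h2 h1) _.
  by rewrite -[leLHS]mulr2n -[leRHS]mulrA [leRHS]mulr_natl.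
have [Phi [P1 P2 P3 P4]] := exists_maximal_square i0 mD su sv sP sQ TL TB A_ge0 A0_ge0 a0 a1 K0 KA.
exists Phi; split => //.
- move=> x t N ht hN1 hN2.
  have iP' : [&& (t, N).1 \in `[-1, 1], lam <= (t, N).2%:R & (t, N).2%:R <= 2 * lam].
    by rewrite /= ht hN1.
  by have := P3 x (exist _ (t, N) iP'); rewrite oscE.
- apply: (le_trans P4); rewrite le_eqVlt; apply/orP; left; apply/eqP.
  by congr (_ * _); field; rewrite gt_eqF.
Qed.

End block_maximal.

(** * Plancherel's inequality for truncated Fourier integrals *)

Section plancherel.
Context {R : realType}.
Local Notation mu := (@lebesgue_measure R).

Lemma sin_natpi (k : nat) : sin (pi *+ k) = 0 :> R.
Proof. by elim: k => [|k ih]; rewrite ?mulr0n ?sin0// mulrSr sinDpi ih oppr0. Qed.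

Lemma Rintegral_cos_scaled (c X : R) : 0 <= X -> c != 0 ->
  (\int[mu]_(x in `[- X, X]) cos (c * x) = 2 * sin (c * X) / c)%R.
Proof.
move=> X0 c0.
have XX : - X <= X by lra.
have dcx (x : R) : is_derive x 1 (fun y : R => c * y) c.
  apply: (is_derive_eq (is_deriveZ c (is_derive_id x 1))).
  by rewrite /GRing.scale/= mulr1.
have ccx (x : R) : {for x, continuous (fun y : R => cos (c * y))}.
  apply: (continuous_comp (g := cos)); last exact: continuous_cos.
  exact: is_derive1_continuous (dcx x).
have ds (e x : R) : is_derive x 1 (fun y : R => e * (sin (c * y) / c)) (e * cos (c * x)).
  have h := dcx x.
  have h1 : is_derive x 1 (fun y : R => sin (c * y)) (c * cos (c * x)).
    by apply: is_derive_eq; rewrite /GRing.scale/= mulrC.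
  rewrite (_ : (fun y : R => _) = (fun y : R => (e / c) * sin (c * y))); last first.
    by apply/funext => y; ring.
  apply: (is_derive_eq (is_deriveZ (e / c) h1)).
  by rewrite /GRing.scale/=; field.
(* The one-sided comparison with a primitive gives the equality when used for $e = 1$ and $e =
   -1$. *)
have E e : (e * \int[mu]_(x in `[- X, X]) cos (c * x))%R <= e * (2 * sin (c * X) / c).
  rewrite -RintegralZl//; last by apply: continuous_itv_integrable => x _.
  have ce x : x \in `[- X, X] -> {for x, continuous (fun y : R => e * cos (c * y))}.
    by move=> _; apply: continuousM; [exact: cvg_cst|exact: ccx].
  have := le_Rintegral_increment XX ce (fun x _ => ds e x) (fun x _ => lexx _).
  rewrite mulrN sinN => /le_trans; apply.
  by rewrite le_eqVlt; apply/orP; left; apply/eqP; ring.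
apply/eqP; rewrite eq_le; apply/andP; split.
  by have := E 1; rewrite !mul1r.
by have := E (-1); rewrite !mulN1r lerN2.
Qed.

Lemma big_ord_mul (K q : nat) (f : nat -> R) :
  \sum_(j < K * q) f j = \sum_(k < K) \sum_(r < q) f (k * q + r)%N.
Proof.
elim: K f => [|K ih] f; first by rewrite mul0n !big_ord0.
rewrite big_ord_recl/= mul0n mulSn big_split_ord/=; congr (_ + _).
rewrite (ih (fun j => f (q + j)%N)); apply: eq_bigr => k _; apply: eq_bigr => r _.
by rewrite /bump/= add1n mulSn addnA.
Qed.

Section truncated.
Variables (X : R) (u v : R -> R).
Hypothesis X0 : 0 < X.
Let D : set R := `[- X, X].
Hypotheses (su : square_integrable mu D u) (sv : square_integrable mu D v).

Definition fourier_phase (xi x : R) : R := - (x * xi).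

(** The real part of the Fourier transform of $(u + i v) 1_{[-X, X]}$. *)
Definition fourier_osc (xi : R) : R := osc D (fourier_phase xi) u v.

Let mD : measurable D. Proof. exact: measurable_itv. Qed.

Let Doo : (mu D < +oo)%E.
Proof. by rewrite lebesgue_measure_itv/=; case: ifP => _; rewrite ?ltry// -EFinB ltry. Qed.

Let mphase (E : set R) xi : measurable_fun E (fourier_phase xi).
Proof. by apply: measurable_funTS; apply: measurableT_comp => //; apply: measurable_funM. Qed.

Let G := (\int[mu]_(x in D) (`|u x| + `|v x|))%R.

Lemma fourier_osc_lipschitz xi eta :
  `|fourier_osc xi - fourier_osc eta| <= X * G * `|xi - eta|.
Proof.
rewrite [leRHS](_ : _ = X * `|xi - eta| * G); last by ring.
apply: osc_lipschitz => //; first by rewrite mulr_ge0// ltW.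
move=> x; rewrite /D/= in_itv/= => xX; rewrite /fourier_phase -opprD normrN -mulrBr normrM.
by rewrite ler_wpM2r// ler_norml.
Qed.

Lemma fourier_osc_bound xi : `|fourier_osc xi| <= G.
Proof. exact: le_norm_osc. Qed.

Lemma fourier_osc_sq_lipschitz xi eta :
  `|fourier_osc xi ^+ 2 - fourier_osc eta ^+ 2| <= X * G * (2 * G) * `|xi - eta|.
Proof.
rewrite subr_sqr normrM mulrAC; apply: ler_pM => //; first exact: fourier_osc_lipschitz.
apply: le_trans (ler_normD _ _) _.
by rewrite mulr2n mulrDl mul1r lerD// fourier_osc_bound.
Qed.

(* On [- X, X] the exponentials of frequencies spaced by $\pi / X$ are orthogonal. *)
Lemma fourier_osc_grid (n : nat) (a : R) :
  \sum_(k < n) fourier_osc (a + pi / X *+ k) ^+ 2 <= 2 * X * pairing mu D u v u v.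
Proof.
have sP xi := square_integrable_osc mD Doo mD (mphase xi).
pose xi (k : 'I_n) := a + pi / X *+ k.
have E k : fourier_osc (xi k) =
      pairing mu D u v (osc_cos D (fourier_phase (xi k))) (osc_sin D (fourier_phase (xi k))).
  by rewrite pairing_osc.
under eq_bigr do rewrite -/(xi _) E.
apply: (@bessel_almost_orthogonal _ _ _ mu D mD n (fun k => osc_cos D (fourier_phase (xi k)))
  (fun k => osc_sin D (fourier_phase (xi k)))) => //.
- by rewrite mulr_gt0.
- by move=> k; have [] := sP (xi k).
- by move=> k; have [] := sP (xi k).
(* Each row reduces to its diagonal entry $2 X$: elsewhere the integral is $2 \sin(c X) / c$ with $c
   X$ a multiple of $\pi$. *)
move=> j; rewrite (bigD1 j)//= big1 ?addr0; last first.
  move=> k kj; rewrite pairing_osc_osc// setIid.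
  pose c := xi k - xi j.
  have cE : c = (k%:R - j%:R) * (pi / X).
    by rewrite /c /xi opprD addrACA subrr add0r mulrBl !mulr_natl.
  have c0 : c != 0.
    have pX : 0 < pi / X by rewrite divr_gt0 ?pi_gt0.
    by rewrite cE mulf_neq0 ?(gt_eqF pX)// subr_eq0 eqr_nat.
  have -> : (\int[mu]_(x in D) cos (fourier_phase (xi j) x - fourier_phase (xi k) x) =
      \int[mu]_(x in D) cos (c * x))%R.
    by apply: eq_Rintegral => x _; congr cos; rewrite /fourier_phase /c; ring.
  rewrite Rintegral_cos_scaled// ?(ltW X0)//.
  have -> : c * X = pi *+ k - pi *+ j.
    by rewrite cE -!(mulr_natl pi); field; rewrite gt_eqF.
  by rewrite sinB !sin_natpi mul0r mulr0 subrr mulr0 mul0r normr0.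
rewrite pairing_osc_osc// setIid.
under eq_Rintegral do rewrite subrr cos0.
rewrite Rintegral_cst//= lebesgue_measure_itv/= lte_fin mul1r.
case: ifP => h; last by rewrite /= normr0 mulr_ge0// ltW.
rewrite -EFinB/= ger0_norm; lra.
Qed.

(** Enlarge $[-M, M]$ to a union of $2J$ cells of length $\pi / X$ and cut each cell into $q$. The
    fine grid consists of $q$ translates of an orthogonal grid, each contributing at most $2 X E$;
    with the step $\pi / (X q)$ the Riemann sum is at most $2 \pi E$ for every $q$. *)
Lemma truncated_plancherel (M : R) : 0 <= M ->
  (\int[mu]_(xi in `[- M, M]) fourier_osc xi ^+ 2 <= 2 * pi * pairing mu D u v u v)%R.
Proof.
move=> M0; set E := pairing _ _ _ _ _ _.
have pX : 0 < pi / X by rewrite divr_gt0 ?pi_gt0.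
pose J := (Num.bound (M / (pi / X))).+1.
pose M' := (pi / X) *+ J.
have MM' : M <= M'.
  rewrite /M' -mulr_natr -ler_pdivrMl// mulrC.
  have MX0 : 0 <= M / (pi / X) by rewrite divr_ge0// ltW.
  by rewrite (le_trans (ltW (archi_boundP MX0)))// ler_nat.
have cF : continuous (fun xi => fourier_osc xi ^+ 2).
  exact: lipschitz_continuous fourier_osc_sq_lipschitz.
apply: (@le_trans _ _ (\int[mu]_(xi in `[- M', M']) fourier_osc xi ^+ 2)%R).
  have h1 : - M' <= - M by rewrite lerN2.
  have h2 : - M <= M' by lra.
  rewrite (Rintegral_itv_chasles h1 h2 (fun x _ => cF x)).
  have h3 : - M <= M by lra.
  rewrite (Rintegral_itv_chasles h3 MM' (fun x _ => cF x)) addrCA lerDl.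
  by rewrite addr_ge0//; apply: Rintegral_ge0 => x _; exact: sqr_ge0.
apply: (le_Rintegral_of_riemann_sums _ fourier_osc_sq_lipschitz).
  by rewrite -subr_ge0 opprK addr_ge0// mulrn_wge0// ltW.
move=> eta n0 eta0.
pose q := maxn n0 1.
have q1 : (0 < q)%N by rewrite /q leq_max leqnn orbT.
have qR : 0 < q%:R :> R by rewrite ltr0n.
exists (J.*2 * q)%N; split.
- have n0q : (n0 <= q)%N by rewrite /q leq_max leqnn.
  by rewrite (leq_trans n0q)// leq_pmull// double_gt0.
- by rewrite muln_gt0 double_gt0.
have -> : (M' - - M') / (J.*2 * q)%N%:R = pi / X / q%:R.
  rewrite /M' natrM -muln2 natrM -mulr_natr; field.
  by rewrite gt_eqF//= gt_eqF//= gt_eqF.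
set w := pi / X / q%:R.
have w0 : 0 < w by rewrite divr_gt0.
have wq : w *+ q = pi / X by rewrite -(mulr_natr w) /w divfK ?gt_eqF.
rewrite (big_ord_mul _ _ (fun j => fourier_osc (- M' + w *+ j) ^+ 2)) exchange_big/=.
apply: (@le_trans _ _ (\sum_(r < q) 2 * X * E * w)).
  (* For a fixed remainder [r] the frequencies are spaced by exactly $\pi / X$. *)
  rewrite mulr_suml; apply: ler_sum => r _; rewrite ler_wpM2r ?(ltW w0)//.
  under eq_bigr do rewrite addnC mulrnDr mulnC mulrnA wq addrA.
  exact: fourier_osc_grid.
rewrite sumr_const card_ord -(mulr_natr (2 * X * E * w)) /w.
rewrite [leLHS](_ : _ = 2 * pi * E); first by rewrite lerDl ltW.
by field; rewrite !gt_eqF.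
Qed.

End truncated.
End plancherel.

(** * Integrals of nonnegative functions, measurable or not *)

Section nonneg_integral.
Context {d : measure_display} {T : measurableType d} {R : realType}
  (mu : {measure set T -> \bar R}).
Local Open Scope ereal_scope.

(* Used for a supremum over uncountably many [t], which [ge0_le_integral] would require
   to be measurable. *)
Lemma le_nonneg_integral (D : set T) (f g : T -> \bar R) :
  (forall x, D x -> 0 <= f x) -> (forall x, D x -> f x <= g x) ->
  \int[mu]_(x in D) f x <= \int[mu]_(x in D) g x.
Proof.
move=> f0 fg; have g0 x : D x -> 0 <= g x by move=> Dx; rewrite (le_trans (f0 _ Dx))// fg.
rewrite !ge0_integralE//; apply: le_ereal_sup => _ [h /= hf <-]; exists h => //= x.
by apply: (le_trans (hf x)); exact: lee_restrict.
Qed.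

Lemma EFin_Rintegral (D : set T) (f : T -> R) : measurable D ->
  mu.-integrable D (EFin \o f) -> (\int[mu]_(x in D) f x)%R%:E = \int[mu]_(x in D) (f x)%:E.
Proof. by move=> mD iF; rewrite /Rintegral fineK//; exact: integrable_fin_num. Qed.

End nonneg_integral.

(** * Plancherel's inequality for the $L^2$ transform *)

Section complex_plancherel.
Context {R : realType}.
Local Notation mu := (@lebesgue_measure R).
Implicit Types (f g h : R -> R[i]).

Definition sqmod (z : R[i]) : R := complex.Re z ^+ 2 + complex.Im z ^+ 2.

Lemma sqmod_ge0 z : 0 <= sqmod z.
Proof. by rewrite addr_ge0 ?sqr_ge0. Qed.

Lemma sqr_normcE z : Normc.normc z ^+ 2 = sqmod z.
Proof. by case: z => a b; rewrite /Normc.normc sqr_sqrtr// addr_ge0 ?sqr_ge0. Qed.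

Lemma normc_ge0 (z : R[i]) : 0 <= Normc.normc z.
Proof. by case: z => a b; exact: sqrtr_ge0. Qed.

Lemma measurable_sqmod (D : set R) f : Cmeasurable f ->
  measurable_fun D (fun x => sqmod (f x)).
Proof.
by move=> [mr mi]; apply: measurable_funTS; apply: measurable_funD; exact: measurable_funX.
Qed.

Lemma L2norm_sq f : ((L2norm f) `^ 2 = \int[mu]_x (sqmod (f x))%:E)%E.
Proof.
rewrite /L2norm poweR_Lnorm//; apply: eq_integral => x _.
by rewrite abse_EFin poweR_EFin powR_mulrn ?normr_ge0// ger0_norm ?normc_ge0// sqr_normcE.
Qed.

Lemma isL2_square_integrable f (D : set R) : isL2 f -> measurable D ->
  square_integrable mu D (fun x => complex.Re (f x)) /\
  square_integrable mu D (fun x => complex.Im (f x)).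
Proof.
move=> [mf fL2] mD.
have foo : (\int[mu]_x (sqmod (f x))%:E < +oo)%E.
  by rewrite -L2norm_sq poweR_lty.
have ifs : mu.-integrable setT (EFin \o (fun x => sqmod (f x))).
  apply/integrableP; split; first by apply/measurable_EFinP; apply: measurable_sqmod.
  apply: le_lt_trans foo; apply: le_nonneg_integral => x _ //.
  by rewrite /= ger0_norm ?sqmod_ge0.
have ifD : mu.-integrable D (EFin \o (fun x => sqmod (f x))).
  by apply: integrableS ifs.
case: mf => mr mi.
split; split; try exact: measurable_funTS.
- apply: (@le_sq_integrable _ _ _ mu D mD _ _ _ ifD); first by apply: measurable_funX; exact: measurable_funTS.
  by move=> x _; rewrite ger0_norm ?sqr_ge0// lerDl sqr_ge0.
- apply: (@le_sq_integrable _ _ _ mu D mD _ _ _ ifD); first by apply: measurable_funX; exact: measurable_funTS.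
  by move=> x _; rewrite ger0_norm ?sqr_ge0// lerDr sqr_ge0.
Qed.

Lemma fourier_truncE (N : nat) f xi :
  fourier_trunc N f xi =
  (fourier_osc N%:R (fun x => complex.Re (f x)) (fun x => complex.Im (f x)) xi +i*
   fourier_osc N%:R (fun x => complex.Im (f x)) (fun x => - complex.Re (f x)) xi)%C.
Proof.
rewrite /fourier_trunc /Cintegral /fourier_osc /osc /fourier_phase; congr (_ +i* _)%C.
- by apply: eq_Rintegral => x _; case: (f x) => a b; rewrite /cexp /=; ring.
- by apply: eq_Rintegral => x _; case: (f x) => a b; rewrite /cexp /=; ring.
Qed.

Lemma square_integrableN (D : set R) (u : R -> R) :
  square_integrable mu D u -> square_integrable mu D (fun x => - u x).
Proof.
move=> [mu_ iu]; split; first exact: measurableT_comp.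
by under [X in _ \o X]eq_fun do rewrite sqrrN.
Qed.

Lemma pairing_sqmod f (D : set R) : measurable D -> isL2 f ->
  (pairing mu D (fun x => complex.Re (f x)) (fun x => complex.Im (f x))
    (fun x => complex.Re (f x)) (fun x => complex.Im (f x)))%:E =
  (\int[mu]_(x in D) (sqmod (f x))%:E)%E.
Proof.
move=> mD fL2; have [s1 s2] := isL2_square_integrable fL2 mD.
rewrite EFin_Rintegral; [|by []|exact: (pairing_integrable mu)].
by apply: eq_integral => x _; rewrite /sqmod !expr2.
Qed.

(** The real and the imaginary part are each bounded by $2\pi$ times the whole energy, because $(v,
    -u)$ has the same energy as $(u, v)$; hence $4\pi$. *)
Lemma integral_fourier_trunc (N : nat) (M : R) f : (0 < N)%N -> 0 <= M -> isL2 f ->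
  (\int[mu]_(xi in `[(- M)%R, M]) (sqmod (fourier_trunc N f xi))%:E <=
    (4 * pi)%:E * \int[mu]_x (sqmod (f x))%:E)%E.
Proof.
move=> N0 M0 fL2.
have NR : 0 < N%:R :> R by rewrite ltr0n.
pose a x := complex.Re (f x); pose b x := complex.Im (f x).
have [sa sb] : square_integrable mu `[- N%:R, N%:R] a /\ square_integrable mu `[- N%:R, N%:R] b.
  exact: isL2_square_integrable.
have sa' := square_integrableN sa.
have i1 : mu.-integrable `[- M, M] (EFin \o (fun xi => fourier_osc N%:R a b xi ^+ 2)).
  apply: continuous_itv_integrable => x _.
  exact: (lipschitz_continuous (fourier_osc_sq_lipschitz NR sa sb)).
have i2 : mu.-integrable `[- M, M] (EFin \o (fun xi => fourier_osc N%:R b (fun x => - a x) xi ^+ 2)).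
  apply: continuous_itv_integrable => x _.
  exact: (lipschitz_continuous (fourier_osc_sq_lipschitz NR sb sa')).
have t1 := truncated_plancherel NR sa sb M0.
have t2 := truncated_plancherel NR sb sa' M0.
have -> : (\int[mu]_(xi in `[(- M)%R, M]) (sqmod (fourier_trunc N f xi))%:E =
    (\int[mu]_(xi in `[(- M)%R, M]) fourier_osc N%:R a b xi ^+ 2 +
     \int[mu]_(xi in `[(- M)%R, M]) fourier_osc N%:R b (fun x => - a x)%R xi ^+ 2)%R%:E)%E.
  rewrite -RintegralD; [|by []|exact: i1|exact: i2].
  rewrite EFin_Rintegral; [|by []|by apply: (integrable_EFinD mu _ i1 i2)].
  by apply: eq_integral => xi _; rewrite fourier_truncE /sqmod.
apply: (@le_trans _ _ ((4 * pi)%:E * \int[mu]_(x in `[(- N%:R)%R, N%:R]) (sqmod (f x))%:E)%E).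
  rewrite -pairing_sqmod// -EFinM lee_fin.
  apply: (le_trans (lerD t1 t2)).
  have -> : pairing mu `[- N%:R, N%:R] b (fun x => - a x) b (fun x => - a x) =
      pairing mu `[- N%:R, N%:R] a b a b.
    by apply: eq_Rintegral => x _; ring.
  by rewrite -mulrDl le_eqVlt; apply/orP; left; apply/eqP; congr (_ * _); ring.
rewrite lee_wpmul2l ?lee_fin ?mulr_ge0 ?pi_ge0//.
apply: ge0_subset_integral => //.
- by apply/measurable_EFinP; apply: measurable_sqmod; case: fL2.
- by move=> x _; rewrite lee_fin sqmod_ge0.
Qed.

Lemma sqmodB_le (z w : R[i]) : sqmod z <= 2 * sqmod (z - w) + 2 * sqmod w.
Proof.
case: z => a b; case: w => c e; rewrite /sqmod/=.
have := sqr_ge0 (a - c - c); have := sqr_ge0 (b - e - e).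
by nra.
Qed.

Lemma Cmeasurable_fourier_trunc (N : nat) f : (0 < N)%N -> isL2 f ->
  Cmeasurable (fourier_trunc N f).
Proof.
move=> N0 fL2; have NR : 0 < N%:R :> R by rewrite ltr0n.
have [sa sb] : square_integrable mu `[- N%:R, N%:R] (fun x => complex.Re (f x)) /\
    square_integrable mu `[- N%:R, N%:R] (fun x => complex.Im (f x)).
  exact: isL2_square_integrable.
have sa' := square_integrableN sa.
split.
- under eq_fun do rewrite fourier_truncE/=.
  apply: continuous_measurable_fun.
  exact: (lipschitz_continuous (fourier_osc_lipschitz NR sa sb)).
- under eq_fun do rewrite fourier_truncE/=.
  apply: continuous_measurable_fun.
  exact: (lipschitz_continuous (fourier_osc_lipschitz NR sb sa')).
Qed.

Lemma CmeasurableB f g : Cmeasurable f -> Cmeasurable g -> Cmeasurable (fun x => f x - g x).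
Proof.
move=> [a b] [c e]; split.
- rewrite (_ : (fun x => _) = (fun x => complex.Re (f x) - complex.Re (g x))).
    exact: measurable_funB.
  by apply/funext => x; case: (f x) => ? ?; case: (g x).
- rewrite (_ : (fun x => _) = (fun x => complex.Im (f x) - complex.Im (g x))).
    exact: measurable_funB.
  by apply/funext => x; case: (f x) => ? ?; case: (g x).
Qed.

(** The limit in $N$ is taken through $|g|^2 \le 2 |g - g_N|^2 + 2 |g_N|^2$, where $g_N$ is the
    truncated transform. This doubles the constant to $8\pi$. *)
Lemma plancherel_le (M : R) h g : 0 <= M -> is_fourier h g ->
  (\int[mu]_(xi in `[(- M)%R, M]) (sqmod (g xi))%:E <=
    (8 * pi)%:E * \int[mu]_x (sqmod (h x))%:E)%E.
Proof.
move=> M0 [hL2 gL2 cv].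
apply/lee_addgt0Pr => e e0.
(* So that $2 e_1^2 = e$. *)
pose e1 := Num.sqrt (e / 2).
have e10 : 0 < e1 by rewrite sqrtr_gt0 divr_gt0.
have e1n : nbhs (0%E : \bar R) (fun z => (z < e1%:E)%E).
  by apply: open_ereal_lt'; rewrite lte_fin.
have [N0 _ HN] := cv _ e1n.
pose N := N0.+1.
have NN : (N0 <= N)%N by exact: leqnSn.
have {}HN := HN N NN.
have hN := integral_fourier_trunc (ltn0Sn N0) M0 hL2.
have mh := Cmeasurable_fourier_trunc (ltn0Sn N0) hL2.
have [mg _] := gL2.
have md := CmeasurableB mg mh.
have d2 : (\int[mu]_x (sqmod (g x - fourier_trunc N h x)%R)%:E <= (e / 2)%:E)%E.
  rewrite -(L2norm_sq (fun x => (g x - fourier_trunc N h x)%R)).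
  have -> : ((e / 2)%:E = e1%:E `^ 2)%E.
    by rewrite poweR_EFin powR_mulrn ?(ltW e10)// sqr_sqrtr// divr_ge0// ltW.
  apply: gt0_ler_poweR; rewrite ?in_itv/= ?Lnorm_ge0 ?leey ?lee_fin ?(ltW e10)//.
  exact: ltW.
apply: (@le_trans _ _ (\int[mu]_(xi in `[(- M)%R, M])
    (2%:E * (sqmod (g xi - fourier_trunc N h xi)%R)%:E + 2%:E * (sqmod (fourier_trunc N h xi))%:E))%E).
  apply: le_nonneg_integral => x _; first by rewrite lee_fin sqmod_ge0.
  by rewrite -!EFinM -EFinD lee_fin sqmodB_le.
have m1 D : measurable_fun D (fun x => (sqmod (g x - fourier_trunc N h x)%R)%:E).
  by apply/measurable_EFinP; exact: measurable_sqmod.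
have m2 D : measurable_fun D (fun x => (sqmod (fourier_trunc N h x))%:E).
  by apply/measurable_EFinP; exact: measurable_sqmod.
have p (z : R[i]) : (0 <= (sqmod z)%:E)%E by rewrite lee_fin sqmod_ge0.
rewrite ge0_integralD//; last 4 first.
- by move=> x _; rewrite mule_ge0.
- by apply: measurable_funeM; exact: m1.
- by move=> x _; rewrite mule_ge0.
- by apply: measurable_funeM; exact: m2.
rewrite !ge0_integralZl_EFin//; [|exact: m2|exact: m1].
rewrite addeC; apply: leeD.
- have -> : (8 * pi)%:E = (2%:E * (4 * pi)%:E)%E :> \bar R.
    by rewrite -EFinM mulrA -natrM.
  by rewrite -muleA lee_wpmul2l ?lee_fin.
- have -> : e%:E = (2%:E * (e / 2)%:E)%E by rewrite -EFinM mulrC divfK.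
  rewrite lee_wpmul2l ?lee_fin//; apply: le_trans d2.
  by apply: ge0_subset_integral => //; exact: m1.
Qed.

End complex_plancherel.

(** * Sequences controlled on dyadic blocks *)

Section dyadic_sequences.
Context {R : realType}.

(** Blocks contain both endpoints, so that $A_{2^k}$ and $A_{2^{k+1}}$ are compared as well. The
    comparisons then chain into $|A_N - A_{2^k}| \le M r^k / (1 - r)$ for all $N \ge 2^k$, and $k =
    0$ bounds the limit. *)
Lemma dyadic_cauchy (A : nat -> R) (M r : R) : 0 <= M -> 0 <= r -> r < 1 ->
  (forall k N : nat, (2 ^ k <= N)%N -> (N <= 2 ^ k.+1)%N ->
     `|A N - A (2 ^ k)%N| <= M * r ^+ k) ->
  cvgn A /\ `|limn A| <= `|A 1%N| + M / (1 - r).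
Proof.
move=> M0 r0 r1 HA; have r10 : 0 < 1 - r by rewrite subr_gt0.
have dyad k i : `|A (2 ^ (k + i))%N - A (2 ^ k)%N| <= M * (r ^+ k - r ^+ (k + i)) / (1 - r).
  elim: i => [|i ih]; first by rewrite addn0 !subrr normr0 mulr0 mul0r.
  have h := HA (k + i)%N (2 ^ (k + i).+1)%N (leq_pexp2l (ltn0Sn 1) (leqnSn _)) (leqnn _).
  rewrite addnS; apply: le_trans (ler_distD (A (2 ^ (k + i))%N) _ _) _.
  apply: le_trans (lerD h ih) _.
  rewrite exprS le_eqVlt; apply/orP; left; apply/eqP; field.
  by rewrite gt_eqF.
have tail k N : (2 ^ k <= N)%N -> `|A N - A (2 ^ k)%N| <= M * r ^+ k / (1 - r).
  move=> kN; have N0 : (0 < N)%N by rewrite (leq_trans _ kN)// expn_gt0.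
  have /andP[l1 l2] := trunc_log_bounds (ltnSn 1) N0.
  have kl : (k <= trunc_log 2 N)%N by rewrite -(trunc_expnK k (ltnSn 1)) leq_trunc_log.
  have [i li] : exists i, trunc_log 2 N = (k + i)%N.
    by exists (trunc_log 2 N - k)%N; rewrite subnKC.
  rewrite li in l1 l2.
  apply: le_trans (ler_distD (A (2 ^ (k + i))%N) _ _) _.
  apply: le_trans (lerD (HA _ _ l1 (ltnW l2)) (dyad k i)) _.
  rewrite ler_pdivlMr// mulrDl divfK ?gt_eqF//.
  have -> : M * r ^+ (k + i) * (1 - r) + M * (r ^+ k - r ^+ (k + i)) =
    M * r ^+ k - M * (r ^+ (k + i) * r) by ring.
  by rewrite gerBl mulr_ge0// mulr_ge0// exprn_ge0.
have cA : cvgn A.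
  apply/cauchy_cvgP; apply: cauchy_exP => e e0.
  have c0 : (M / (1 - r) * r ^+ k) @[k --> \oo] --> 0.
    rewrite -(mulr0 (M / (1 - r))); apply: cvgMr; apply: cvg_expr.
    by rewrite ger0_norm.
  have [k _ Hk] : \forall k \near \oo, `|0 - M / (1 - r) * r ^+ k| < e.
    by move/cvgrPdist_lt : c0; exact.
  exists (A (2 ^ k)%N); exists (2 ^ k)%N => // N /= kN.
  rewrite /ball/= distrC; apply: le_lt_trans (tail k N kN) _.
  have := Hk k (leqnn k); rewrite sub0r normrN mulrAC.
  exact: le_lt_trans (ler_norm _).
split => //.
rewrite -lim_norm//; apply: limr_le; first exact: is_cvg_norm.
exists 1%N => // N /= N1.
have := tail 0%N N N1; rewrite expr0 mulr1 expn0 => h.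
rewrite -lerBlDl; apply: le_trans h; exact: lerB_dist.
Qed.

End dyadic_sequences.

(** * Truncations to a bounded interval of frequencies *)

Section low_frequencies.
Context {R : realType}.
Local Notation mu := (@lebesgue_measure R).

Lemma itv_measure_lty (a b : R) : (mu `[a, b] < +oo)%E.
Proof. by rewrite lebesgue_measure_itv/=; case: ifP => _; rewrite ?ltry// -EFinB ltry. Qed.

Lemma osc_annulus (r q : R) (phi u v : R -> R) : 0 <= r -> r <= q ->
  measurable_fun setT phi ->
  square_integrable mu `[- q, q] u -> square_integrable mu `[- q, q] v ->
  osc `[- q, q] phi u v - osc `[- r, r] phi u v = osc (annulus r q) phi u v.
Proof.
move=> r0 rq mphi su sv.
pose D : set R := `[- q, q]%classic.
have mD : measurable D by exact: measurable_itv.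
have mphiD : measurable_fun D phi by exact: measurable_funTS.
have sub : `[- r, r]%classic `<=` D.
  by move=> x; rewrite /D/= !in_itv/= => /andP[h1 h2]; rewrite (le_trans _ h1) ?lerN2// (le_trans h2).
have mr : measurable `[- r, r]%classic by exact: measurable_itv.
have [s1 s2] := square_integrable_osc mD (itv_measure_lty _ _) mD mphiD.
have [s3 s4] := square_integrable_osc mD (itv_measure_lty _ _) mr mphiD.
rewrite -/D -(pairing_osc phi u v (@subset_refl _ D)) -(pairing_osc phi u v sub).
rewrite -(pairing_osc phi u v (@annulus_sub_itv _ r q)) pairingBr//.
apply: eq_Rintegral => x xD.
have e : \1_(annulus r q) x = \1_D x - \1_`[- r, r] x :> R.
  rewrite !indicE xD; case: (boolP (x \in `[- r, r]%classic)) => xr.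
    rewrite subrr memNset//= /annulus/= => /andP[+ _].
    by move/set_mem: xr; rewrite /= in_itv/= -ler_norml leNgt => /negP.
  rewrite subr0 mem_set//= /annulus/=.
  move/set_mem: xD; rewrite /D/= in_itv/= -ler_norml => ->; rewrite andbT ltNge.
  by apply/negP => h; move/negP: xr; apply; rewrite inE/= in_itv/= -ler_norml.
by rewrite /osc_cos /osc_sin e; ring.
Qed.

(** The Cauchy-Schwarz inequality, as the case of a single vector, of squared norm $2 r$, in
    Bessel's inequality. *)
Lemma osc_sq_le (phi u v : R -> R) (r : R) : 0 < r -> measurable_fun setT phi ->
  square_integrable mu `[- r, r] u -> square_integrable mu `[- r, r] v ->
  osc `[- r, r] phi u v ^+ 2 <= 2 * r * pairing mu `[- r, r] u v u v.
Proof.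
move=> r0 mphi su sv.
pose D : set R := `[- r, r]%classic.
have mD : measurable D by exact: measurable_itv.
have mphiD : measurable_fun D phi by exact: measurable_funTS.
have [s1 s2] := square_integrable_osc mD (itv_measure_lty _ _) mD mphiD.
have row (j : 'I_1) : \sum_(k < 1) `|pairing mu D (osc_cos D phi) (osc_sin D phi)
    (osc_cos D phi) (osc_sin D phi)| <= 2 * r.
  rewrite big_ord1 pairing_osc_osc// setIid.
  under eq_Rintegral do rewrite subrr cos0.
  rewrite Rintegral_cst//= lebesgue_measure_itv/= lte_fin mul1r.
  case: ifP => h; last by rewrite /= normr0 mulr_ge0// ltW.
  by rewrite -EFinB/= ger0_norm; lra.
have r20 : 0 < 2 * r by rewrite mulr_gt0.
have := @bessel_almost_orthogonal _ _ _ mu D mD 1 (fun=> osc_cos D phi)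
  (fun=> osc_sin D phi) u v (2 * r) r20 su sv (fun=> s1) (fun=> s2) row.
by rewrite big_ord1 (pairing_osc _ _ _ (@subset_refl _ D)).
Qed.

End low_frequencies.

(** * Choice of exponents and summation of the annuli with Sobolev weights *)

Section maximal_majorant.
Context {R : realType}.
Local Notation mu := (@lebesgue_measure R).

(** Take $\sigma$ halfway between the threshold and $s$, and $\theta$ the least weight with $1 -
    \theta m / 2 \le 2\sigma$. Then $\theta \le 1$ follows from $\sigma > 1/4$ and $m > 1$, while
    $\theta / (2\kappa) < 1$ is the condition $\sigma > (1 - m\kappa) / 2$. *)
Lemma exponents_exist (m kappa s : R) : 1 < m -> 0 < kappa ->
  Num.max (1 / 4) ((1 - m * kappa) / 2) < s ->
  exists theta sigma alpha : R,
    [/\ 0 <= theta <= 1, 1 - theta * m / 2 <= 2 * sigma,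
        theta / (2 * kappa) <= alpha, 2^-1 <= alpha < 1 & 2^-1 <= 2 * sigma /\ sigma < s].
Proof.
move=> m1 k0 hs.
have m0 : 0 < m by exact: lt_trans m1.
pose sigma := (Num.max (1 / 4) ((1 - m * kappa) / 2) + s) / 2.
have s1 : Num.max (1 / 4) ((1 - m * kappa) / 2) < sigma by rewrite /sigma; lra.
have ss : sigma < s by rewrite /sigma; lra.
have /andP[s4 sk] : (1 / 4 < sigma) && ((1 - m * kappa) / 2 < sigma) by rewrite -gt_max.
pose theta := Num.max 0 (2 * (1 - 2 * sigma) / m).
have tk : theta / (2 * kappa) < 1.
  rewrite ltr_pdivrMr ?mulr_gt0// mul1r gt_max mulr_gt0//= ltr_pdivrMr//; nra.
exists theta, sigma, (Num.max 2^-1 (theta / (2 * kappa))); split.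
- rewrite le_max lexx/= ge_max ler01/= ler_pdivrMr//; lra.
- have : 2 * (1 - 2 * sigma) / m <= theta by rewrite le_max lexx orbT.
  rewrite ler_pdivrMr//; lra.
- by rewrite le_max lexx orbT.
- rewrite le_max lexx/= gt_max tk andbT; lra.
- by split=> //; lra.
Qed.

Lemma itv_annulus_setU (r q : R) : r <= q ->
  `[- q, q]%classic = `[- r, r]%classic `|` annulus r q.
Proof.
move=> rq; apply/seteqP; split => x; rewrite /annulus/= !in_itv/= -!ler_norml.
- by move=> ->; rewrite andbT; case: (leP `|x| r); [left|right].
- by move=> [h|/andP[]//]; exact: le_trans rq.
Qed.

Lemma disj_itv_annulus (r q : R) : [disjoint `[- r, r]%classic & annulus r q].
Proof.
apply/disj_set2P/seteqP; split => x //=; rewrite /annulus/= in_itv/= -ler_norml.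
by move=> [h /andP[+ _]]; rewrite ltNge h.
Qed.

Lemma sum_annulus_integral (F : R -> \bar R) (K : nat) :
  measurable_fun setT F -> (forall x, 0 <= F x)%E ->
  (\int[mu]_(x in `[(-1)%R, 1%R]) F x +
   \sum_(0 <= k < K) \int[mu]_(x in annulus (2 ^+ k)%R (2 * 2 ^+ k)%R) F x =
   \int[mu]_(x in `[(- (2 ^+ K))%R, (2 ^+ K)%R]) F x)%E.
Proof.
move=> mF F0; elim: K => [|K ih]; first by rewrite big_geq// adde0 expr0.
have p0 : 0 <= 2 ^+ K :> R by rewrite exprn_ge0.
rewrite big_nat_recr//= addeA ih exprS.
rewrite (@itv_annulus_setU (2 ^+ K) (2 * 2 ^+ K)); last by rewrite ler_peMl// ler1n.
rewrite ge0_integral_setU//.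
- exact: measurable_annulus.
- exact: measurable_funTS.
- exact: disj_itv_annulus.
Qed.

Variables (m kappa C1 C2 s : R) (gamma : R -> R -> R).
Hypotheses (m1 : 1 < m) (kappa0 : 0 < kappa) (C10 : 0 < C1) (C20 : 0 < C2).
Hypothesis gamma_t : forall x t t', t \in `[-1, 1] -> t' \in `[-1, 1] ->
  `|gamma x t - gamma x t'| <= C1 * `|t - t'| `^ kappa.
Hypothesis gamma_x : forall t x x', t \in `[-1, 1] ->
  C2^-1 * `|x - x'| <= `|gamma x t - gamma x' t| <= C2 * `|x - x'|.
Hypothesis hs : Num.max (1 / 4) ((1 - m * kappa) / 2) < s.

(** The square of the Bessel multiplier $(1 + \xi^2)^{s/2}$, as it weights $|\hat f|^2$. *)
Definition sobolev_weight (xi : R) : R := (1 + xi ^+ 2) `^ s.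

Let s_gt0 : 0 < s.
Proof. by apply: lt_trans hs; rewrite lt_max divr_gt0. Qed.

Lemma sobolev_weight_ge1 xi : 1 <= sobolev_weight xi.
Proof.
rewrite -[leLHS](powRr0 (1 + xi ^+ 2)) ler_powR ?(ltW s_gt0)//.
by rewrite lerDl sqr_ge0.
Qed.

Lemma sobolev_weight_ge lam xi : 0 <= lam -> lam <= `|xi| -> lam `^ (2 * s) <= sobolev_weight xi.
Proof.
move=> lam0 lx; rewrite powRrM powR_mulrn//; apply: (ge0_ler_powR (ltW s_gt0)).
- by rewrite nnegrE sqr_ge0.
- by rewrite nnegrE addr_ge0// sqr_ge0.
- rewrite -(real_normK (num_real xi)).
  by apply: (@le_trans _ _ (`|xi| ^+ 2)); [rewrite lerXn2r ?nnegrE|rewrite lerDr].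
Qed.

Lemma measurable_sobolev_weight (D : set R) : measurable_fun D sobolev_weight.
Proof.
apply: measurable_funTS.
rewrite (_ : sobolev_weight = (@powR R ^~ s) \o (fun xi => 1 + xi ^+ 2))//.
apply: measurableT_comp => //; apply: measurable_funD => //.
Qed.

(** The weights in $H$ work in both directions. In the integral they turn $\lambda^{2\sigma}$ into
    $\lambda^{2s}$, which the Sobolev weight dominates on each of the disjoint annuli. Pointwise
    they force $\Phi_k(x) \le 2^{-2k(s-\sigma)} H(x)$, a geometric decay from which the truncations
    converge. *)
Lemma maximal_majorant : exists C : R, 0 <= C /\ forall (u v : R -> R) (E : R),
  0 <= E -> measurable_fun setT u -> measurable_fun setT v ->
  (forall M, square_integrable mu `[- M, M] u) ->
  (forall M, square_integrable mu `[- M, M] v) ->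
  (forall M, 0 <= M ->
    (\int[mu]_(xi in `[(- M)%R, M]) (sobolev_weight xi * (u xi ^+ 2 + v xi ^+ 2))%:E <= E%:E)%E) ->
  exists H : R -> \bar R,
    [/\ measurable_fun setT H, forall x, (0 <= H x)%E,
      (\int[mu]_(x in `[(-1)%R, 1%R]) H x <= (C * E)%:E)%E &
      forall x, (H x < +oo)%E -> forall t, t \in `[-1, 1] ->
        let A := fun N : nat => osc `[- N%:R, N%:R] (schrodinger_phase m (gamma x t) t) u v in
        cvgn A /\ limn A ^+ 2 <= C * fine (H x)].
Proof.
have [theta [sigma [alpha [/andP[th0 th1] h1 h2 /andP[ha a1] [hs2 hss]]]]] :=
  exponents_exist m1 kappa0 hs.
have [Cb [Cb0 HB]] := block_maximal m1 kappa0 C10 C20 gamma_t gamma_x th0 th1 h1 h2 ha hs2 a1.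
pose eps := s - sigma.
have eps0 : 0 < eps by rewrite subr_gt0.
pose rho : R := 2 `^ eps.
have rho1 : 1 < rho.
  have := @gt0_ltr_powR _ eps eps0 1 2; rewrite powR1; apply.
  - by rewrite nnegrE.
  - by rewrite nnegrE.
  - by rewrite ltr1n.
have rho0 : 0 < rho by exact: lt_trans rho1.
pose r := rho^-1.
have r0 : 0 <= r by rewrite invr_ge0 ltW.
have r1 : r < 1 by rewrite invf_lt1.
(* With $h = H(x)$, the truncation at 1 is at most $\sqrt h$ and the annuli add at most $\sqrt h
   \sum_k r^k$. *)
pose Cl := (1 + 1 / (1 - r)) ^+ 2.
have Cl0 : 0 <= Cl by exact: sqr_ge0.
(* One constant for both claims: [Cl] is for the pointwise bound, 4 and [Cb] are for the low
   frequencies and the annuli in the integral of [H]. *)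
exists (Cl + 4 + Cb); split; first by rewrite !addr_ge0.
move=> u v E E0 mu_ mv su sv HE.
pose F xi := (sobolev_weight xi * (u xi ^+ 2 + v xi ^+ 2))%:E.
have F0 xi : (0 <= F xi)%E.
  by rewrite lee_fin mulr_ge0 ?addr_ge0 ?sqr_ge0// (le_trans _ (sobolev_weight_ge1 xi)).
have mF : measurable_fun setT F.
  apply/measurable_EFinP; apply: measurable_funM; first exact: measurable_sobolev_weight.
  by apply: measurable_funD; exact: measurable_funX.
pose lam (k : nat) : R := 2 ^+ k.
have lam1 k : 1 <= lam k by rewrite exprn_ege1// ler1n.
have lam0 k : 0 < lam k by exact: lt_le_trans (lam1 k).
pose D k := annulus (lam k) (2 * lam k).
have mD k : measurable (D k) by apply: measurable_annulus; exact: ltW.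
have suD k : square_integrable mu (D k) u /\ square_integrable mu (D k) v.
  have [[_ iu] [_ iv]] := (su (2 * lam k), sv (2 * lam k)).
  split; split; try exact: measurable_funTS.
  - by apply: integrableS iu => //; [exact: mD|exact: annulus_sub_itv].
  - by apply: integrableS iv => //; [exact: mD|exact: annulus_sub_itv].
have /choice[Phi PhiP] k := HB (lam k) u v (lam1 k) (suD k).1 (suD k).2.
pose w k := lam k `^ (2 * eps).
have w0 k : 0 <= w k by exact: powR_ge0.
have wE k : w k = (rho ^+ k) ^+ 2.
  have e1 : lam k = 2 `^ k%:R by rewrite powR_mulrn.
  rewrite /w e1 -powRrM -exprM -(powR_mulrn (k * 2) (ltW rho0)) /rho -powRrM.
  by congr (_ `^ _); rewrite natrM; ring.
(* The Cauchy-Schwarz bound for the squared truncation at frequency 1, the same for all [x] and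
   [t]. *)
pose low := 2 * 1 * pairing mu `[-1, 1] u v u v.
have pE (B : set R) : measurable B -> square_integrable mu B u -> square_integrable mu B v ->
    (pairing mu B u v u v)%:E = (\int[mu]_(x in B) (u x ^+ 2 + v x ^+ 2)%:E)%E.
  move=> mB s1 s2; rewrite EFin_Rintegral; [|by []|exact: (pairing_integrable mu)].
  by apply: eq_integral => x _; rewrite !expr2.
have low0 : 0 <= low.
  by rewrite !mulr_ge0//; apply: Rintegral_ge0 => x _; rewrite -!expr2 addr_ge0 ?sqr_ge0.
have fk0 k x : (0 <= (w k * Phi k x)%:E)%E.
  by rewrite lee_fin mulr_ge0//; have [] := PhiP k.
pose S x := (\sum_(0 <= k <oo) (w k * Phi k x)%:E)%E.
have S0 x : (0 <= S x)%E by apply: nneseries_ge0 => k _ _.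
pose H x := (low%:E + S x)%E.
have mfk k : measurable_fun setT (fun x => (w k * Phi k x)%:E).
  apply/measurable_EFinP; apply: measurable_funM => //.
  by apply: continuous_measurable_fun; have [] := PhiP k.
have mS : measurable_fun setT S by apply: ge0_emeasurable_sum => // k x _ _.
exists H; split.
- by apply: emeasurable_funD; [exact: measurable_cst|exact: mS].
- by move=> x; rewrite adde_ge0// lee_fin.
- rewrite ge0_integralD//; last exact: measurable_funTS.
  rewrite integral_cst//= integral_nneseries//; last first.
    by move=> k; apply: measurable_funTS; exact: mfk.
  rewrite lebesgue_measure_itv/= lte_fin.
  have -> : (-1 < 1 :> R) = true by lra.
  have lowE : (low%:E * (1%:E - (-1)%:E) <= (4 * E)%:E)%E.
    rewrite -EFinB -EFinM lee_fin /low.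
    have pairE : pairing mu `[-1, 1] u v u v <= E.
      rewrite -lee_fin pE; [|exact: measurable_itv|exact: su|exact: sv].
      apply: le_trans (HE 1 ler01); apply: le_nonneg_integral => x _.
        by rewrite lee_fin addr_ge0 ?sqr_ge0.
      by rewrite lee_fin ler_peMl ?addr_ge0 ?sqr_ge0 ?sobolev_weight_ge1.
    rewrite [leLHS](_ : _ = 4 * pairing mu `[-1, 1] u v u v); last by ring.
    by rewrite ler_wpM2l.
  have serE : (\sum_(0 <= k <oo) \int[mu]_(x in `[(-1)%R, 1%R]) (w k * Phi k x)%:E <= (Cb * E)%:E)%E.
    apply: lime_le; first by apply: is_cvg_nneseries => k _ _; exact: integral_ge0.
    apply: nearW => K.
    apply: (@le_trans _ _ (\sum_(0 <= k < K) (Cb%:E * \int[mu]_(x in D k) F x))%E).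
      apply: lee_sum => k _.
      have [cPhi Phi0 _ PhiI] := PhiP k.
      have iPhi : mu.-integrable `[-1, 1] (EFin \o Phi k).
        by apply: continuous_itv_integrable => x _; exact: cPhi.
      rewrite -EFin_Rintegral//; last exact: (integrable_EFinZ mu).
      rewrite RintegralZl//.
      have [s1 s2] := suD k.
      apply: (@le_trans _ _ ((Cb * (lam k `^ (2 * s) * pairing mu (D k) u v u v))%:E)).
        rewrite lee_fin; apply: le_trans (ler_wpM2l (w0 k) PhiI) _.
        rewrite mulrA mulrCA -/(w k) le_eqVlt; apply/orP; left; apply/eqP.
        rewrite -!mulrA; congr (_ * _); rewrite mulrA; congr (_ * _).
        rewrite /w -powRD; last by rewrite (gt_eqF (lam0 k)) implybT.
        by congr (_ `^ _); rewrite /eps; ring.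
      rewrite EFinM lee_wpmul2l ?lee_fin// EFinM pE//.
      rewrite -ge0_integralZl_EFin; last 4 first.
      + exact: mD.
      + by move=> x _; rewrite lee_fin addr_ge0 ?sqr_ge0.
      + apply/measurable_EFinP; apply: measurable_funTS.
        by apply: measurable_funD; exact: measurable_funX.
      + exact: powR_ge0.
      apply: le_nonneg_integral => x Dx.
        by rewrite -EFinM lee_fin mulr_ge0 ?powR_ge0// addr_ge0 ?sqr_ge0.
      rewrite -EFinM lee_fin ler_wpM2r ?addr_ge0 ?sqr_ge0//.
      apply: sobolev_weight_ge; first exact: ltW.
      by move: Dx; rewrite /D/annulus/= => /andP[/ltW].
    apply: (@le_trans _ _ (Cb%:E * \sum_(0 <= k < K) \int[mu]_(x in D k) F x)%E).
      by rewrite ge0_sume_distrr// => k _; exact: integral_ge0.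
    rewrite EFinM lee_wpmul2l ?lee_fin//.
    apply: le_trans (HE (2 ^+ K) (exprn_ge0 _ (ler0n _ 2))).
    rewrite -/(F _) -(sum_annulus_integral K mF F0) leeDr//.
    exact: integral_ge0.
  apply: (le_trans (leeD lowE serE)); rewrite -EFinD lee_fin.
  have -> : (Cl + 4 + Cb) * E = Cl * E + (4 * E + Cb * E) by ring.
  by rewrite lerDr mulr_ge0.
- move=> x Hx t ht A.
  have Sfin : S x \is a fin_num.
    rewrite ge0_fin_numE//; apply: le_lt_trans Hx.
    by rewrite /H leeDr// lee_fin.
  pose h := fine (H x).
  have hE : h = low + fine (S x) by rewrite /h /H fineD.
  have hS : fine (S x) <= h by rewrite hE lerDr.
  have hlow : low <= h by rewrite hE lerDl fine_ge0.
  have h0 : 0 <= h by exact: le_trans hlow.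
  have Phih k : w k * Phi k x <= h.
    apply: le_trans hS; rewrite -lee_fin fineK//.
    apply: le_trans (nneseries_lim_ge k.+1 _) => /=; last by move=> i _.
    by rewrite big_nat_recr//= leeDr// sume_ge0.
  pose phi := schrodinger_phase m (gamma x t) t.
  have mphi : measurable_fun setT phi by exact: measurable_schrodinger_phase.
  have lamN k : (2 ^ k)%N%:R = lam k by rewrite natrX.
  have HA k N : (2 ^ k <= N)%N -> (N <= 2 ^ k.+1)%N ->
      `|A N - A (2 ^ k)%N| <= Num.sqrt h * r ^+ k.
    move=> kN Nk.
    have l1 : lam k <= N%:R by rewrite -lamN ler_nat.
    have l2 : N%:R <= 2 * lam k.
      by rewrite -lamN -natrM ler_nat -expnS.
    have -> : A N - A (2 ^ k)%N = osc (annulus (lam k) N%:R) phi u v.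
      by rewrite /A lamN osc_annulus// ltW.
    have [_ _ Phi1 _] := PhiP k.
    have := Phi1 x t N ht l1 l2; set o := osc _ _ _ _ => oPhi.
    rewrite -(@ler_pXn2r _ 2%N)// ?nnegrE ?mulr_ge0 ?sqrtr_ge0 ?exprn_ge0//.
    rewrite real_normK ?num_real// exprMn sqr_sqrtr//.
    apply: (le_trans oPhi); rewrite /r exprVn exprVn ler_pdivlMr; last first.
      by rewrite exprn_gt0// exprn_gt0.
    by rewrite mulrC -wE.
  have [cA limA] := dyadic_cauchy (sqrtr_ge0 h) r0 r1 HA.
  split => //.
  have A1 : `|A 1%N| <= Num.sqrt h.
    rewrite -(@ler_pXn2r _ 2%N)// ?nnegrE ?sqrtr_ge0// real_normK ?num_real//.
    rewrite sqr_sqrtr//; apply: le_trans hlow.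
    by apply: osc_sq_le.
  have lim2 : `|limn A| <= Num.sqrt h * (1 + 1 / (1 - r)).
    apply: (le_trans limA); rewrite mulrDr mulr1 mul1r.
    by rewrite lerD.
  rewrite -real_normK ?num_real//.
  apply: (@le_trans _ _ (Cl * h)).
    rewrite /Cl -[X in _ <= _ * X](sqr_sqrtr h0) -exprMn mulrC.
    by rewrite lerXn2r ?nnegrE// (le_trans _ lim2).
  by rewrite ler_wpM2r// -addrA lerDl addr_ge0.
Qed.

End maximal_majorant.

(** * The evolution and the Sobolev energy in real components *)

Section evolution.
Context {R : realType}.
Local Notation mu := (@lebesgue_measure R).

Lemma complex_scaled_cvg (c a b : R) (A B : nat -> R) : 0 < c ->
  A n @[n --> \oo] --> a -> B n @[n --> \oo] --> b ->
  (fun n => (c%:C * (A n +i* B n))%C : R[i]^o) @ \oo --> ((c%:C * (a +i* b))%C : R[i]^o).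
Proof.
move=> c0 Aa Bb; apply/cvgrPdist_lt => e e0.
(* In the order of [R[i]] a positive element is a positive real number. *)
have [e' e'0 eE] : exists2 e' : R, 0 < e' & e = (e'%:C)%C.
  by move: e0; case: e => e1 e2; rewrite ltcE/= => /andP[/eqP -> h]; exists e1.
have d0 : 0 < e' / (2 * c) by rewrite divr_gt0// mulr_gt0.
have hA : \forall n \near \oo, `|a - A n| < e' / (2 * c) by move/cvgrPdist_lt : Aa; exact.
have hB : \forall n \near \oo, `|b - B n| < e' / (2 * c) by move/cvgrPdist_lt : Bb; exact.
near=> n.
have a1 : `|a - A n| < e' / (2 * c) by near: n.
have b1 : `|b - B n| < e' / (2 * c) by near: n.
rewrite eE -mulrBr.
have -> : ((a +i* b)%C - (A n +i* B n)%C = (a - A n) +i* (b - B n))%C by [].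
rewrite normc_def/= ltcR.
set p := a - A n in a1 *; set q := b - B n in b1 *.
rewrite -[ltRHS](ger0_norm (ltW e'0)) -sqrtr_sqr ltr_sqrt ?exprn_gt0//.
rewrite !mul0r subr0 addr0 !exprMn -mulrDr.
have p2 : p ^+ 2 < (e' / (2 * c)) ^+ 2.
  by rewrite -real_normK ?num_real// ltrXn2r ?nnegrE// ltW.
have q2 : q ^+ 2 < (e' / (2 * c)) ^+ 2.
  by rewrite -real_normK ?num_real// ltrXn2r ?nnegrE// ltW.
apply: (@lt_le_trans _ _ (c ^+ 2 * (2 * (e' / (2 * c)) ^+ 2))).
  by rewrite ltr_pM2l ?exprn_gt0//; lra.
have -> : c ^+ 2 * (2 * (e' / (2 * c)) ^+ 2) = e' ^+ 2 / 2 by field; rewrite gt_eqF.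
by have := sqr_ge0 e'; lra.
Unshelve. all: by end_near. Qed.

Lemma evol_truncE (m t : R) (f : R -> R[i]) (x : R) (N : nat) :
  evol_trunc m t f x N =
  (((2 * pi)^-1)%:C *
   (osc `[- N%:R, N%:R] (schrodinger_phase m x t)
     (fun xi => complex.Re (fourier f xi)) (fun xi => complex.Im (fourier f xi)) +i*
    osc `[- N%:R, N%:R] (schrodinger_phase m x t)
     (fun xi => complex.Im (fourier f xi)) (fun xi => - complex.Re (fourier f xi))))%C.
Proof.
rewrite /evol_trunc /Cintegral /osc /schrodinger_phase; congr (_ * (_ +i* _))%C.
- by apply: eq_Rintegral => xi _; case: (fourier f xi) => a b; rewrite /cexp /=; ring.
- by apply: eq_Rintegral => xi _; case: (fourier f xi) => a b; rewrite /cexp /=; ring.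
Qed.

Lemma square_integrable_le (D : set R) (u v : R -> R) : measurable D ->
  measurable_fun D u -> square_integrable mu D v -> (forall x, D x -> `|u x| <= `|v x|) ->
  square_integrable mu D u.
Proof.
move=> mD mu_ [mv iv] uv; split => //.
apply: (@le_sq_integrable _ _ _ mu D mD _ _ _ iv); first exact: measurable_funX.
move=> x Dx; rewrite ger0_norm ?sqr_ge0//.
by rewrite -(real_normK (num_real (u x))) -(real_normK (num_real (v x))) lerXn2r ?nnegrE ?uv.
Qed.

(** The weighted energy of $\hat f$ is the energy of the transform [g] of [h], to which Plancherel's
    inequality applies. Measurability and local square integrability of [fourier f] are also read
    off [g], after division by a weight that is at least 1. *)
Lemma is_bessel_energy (s : R) (f h : R -> R[i]) : 0 <= s -> is_bessel s f h ->
  let u xi := complex.Re (fourier f xi) in let v xi := complex.Im (fourier f xi) in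
  [/\ measurable_fun setT u, measurable_fun setT v,
     forall M, square_integrable mu `[- M, M] u /\ square_integrable mu `[- M, M] v &
     forall M, 0 <= M ->
       (\int[mu]_(xi in `[(- M)%R, M]) (sobolev_weight s xi * (u xi ^+ 2 + v xi ^+ 2))%:E <=
         (8 * pi)%:E * \int[mu]_x (sqmod (h x))%:E)%E].
Proof.
move=> s0 hb u v.
pose w xi : R := (1 + xi ^+ 2) `^ (s / 2).
pose g xi := ((w xi)%:C * fourier f xi)%C.
have hg : is_fourier h g by exact: hb.
have x1 xi : 1 <= 1 + xi ^+ 2 :> R by rewrite lerDl sqr_ge0.
have w1 xi : 1 <= w xi.
  by rewrite /w -[leLHS](powRr0 (1 + xi ^+ 2)) ler_powR// divr_ge0.
have w0 xi : 0 < w xi by exact: lt_le_trans (w1 xi).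
have gr xi : complex.Re (g xi) = w xi * u xi.
  by rewrite /g /u; case: (fourier f xi) => a b /=; rewrite mul0r subr0.
have gi xi : complex.Im (g xi) = w xi * v xi.
  by rewrite /g /v; case: (fourier f xi) => a b /=; rewrite mul0r addr0.
have [_ gL2 _] := hg.
have [[mgr mgi] _] := gL2.
have mw : measurable_fun setT (fun xi => (w xi)^-1).
  rewrite (_ : (fun _ => _) = (@powR R ^~ (- (s / 2))) \o (fun xi => 1 + xi ^+ 2)).
    by apply: measurableT_comp => //; apply: measurable_funD.
  by apply/funext => xi /=; rewrite powRN.
have mu_ : measurable_fun setT u.
  rewrite (_ : u = fun xi => (w xi)^-1 * complex.Re (g xi)); first exact: measurable_funM.
  by apply/funext => xi; rewrite gr mulKf ?gt_eqF.
have mv : measurable_fun setT v.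
  rewrite (_ : v = fun xi => (w xi)^-1 * complex.Im (g xi)); first exact: measurable_funM.
  by apply/funext => xi; rewrite gi mulKf ?gt_eqF.
split => //.
- move=> M.
  have mM : measurable (`[- M, M]%classic : set R) by exact: measurable_itv.
  have [sr si] := isL2_square_integrable gL2 mM.
  split.
  + apply: (square_integrable_le mM _ sr); first exact: measurable_funTS.
    by move=> xi _; rewrite gr normrM (gtr0_norm (w0 xi)) ler_peMl.
  + apply: (square_integrable_le mM _ si); first exact: measurable_funTS.
    by move=> xi _; rewrite gi normrM (gtr0_norm (w0 xi)) ler_peMl.
- move=> M M0.
  rewrite (_ : (\int[mu]_(xi in _) _)%E = (\int[mu]_(xi in `[(- M)%R, M]) (sqmod (g xi))%:E)%E).
    exact: plancherel_le.
  apply: eq_integral => xi _; congr (_%:E).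
  rewrite /sqmod gr gi !exprMn -mulrDr; congr (_ * _).
  rewrite /sobolev_weight /w -[RHS](powR_mulrn 2 (powR_ge0 _ _)) -powRrM.
  by congr (_ `^ _); rewrite divfK.
Qed.

End evolution.

(** As [evol] has a junk value where the limit fails to exist, the existence of the limits is part
    of the conclusion; the exceptional null set of [x] is common to all [t]. *)
Theorem corollary4 (R : realType) (m kappa s : R) (gamma : R -> R -> R)
    (hm : 1 < m) (hkappa0 : 0 < kappa) (hkappa1 : kappa <= 1)
    (hgamma : Gamma_class kappa gamma)
    (hs : Num.max (1 / 4) ((1 - m * kappa) / 2) < s) :
  exists C : R, forall f : R -> R[i], sobolev s f ->
    {ae lebesgue_measure, forall x : R, x \in `[-1, 1] ->
       forall t : R, t \in `[-1, 1] -> evol_defined m t f (gamma x t)} /\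
    ((\int[lebesgue_measure]_(x in `[(-1)%R, 1%R])
        ereal_sup [set (Normc.normc (evol m t f (gamma x t)) ^+ 2)%:E
                  | t in `[(-1)%R, 1%R]]) `^ 2^-1
      <= C%:E * sobolev_norm s f)%E.
Proof.
have s0 : 0 < s by apply: lt_trans hs; rewrite lt_max divr_gt0.
case: hgamma => _ _ [C1 [C2 [C10 C20 gt gx]]].
have [C0 [C00 HC]] := maximal_majorant hm hkappa0 C10 C20 gt gx hs.
pose c : R := (2 * pi)^-1.
have c0 : 0 < c by rewrite invr_gt0 mulr_gt0 ?pi_gt0.
(* The summand 1 makes [K0] positive, so that the bound is indeed $+\infty$ wherever a majorant is
   infinite. *)
pose K0 := c ^+ 2 * (C0 + 1).
have K00 : 0 < K0 by rewrite mulr_gt0 ?exprn_gt0// ltr_wpDl.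
(* Two components, each with a majorant of integral at most $C_0 E$, where $E = 8 \pi \|h\|_2^2$. *)
pose K1 := K0 * (2 * C0 * (8 * pi)).
have K10 : 0 <= K1 by rewrite /K1 mulr_ge0 ?(ltW K00)// !mulr_ge0 ?pi_ge0.
exists (K1 `^ 2^-1) => f [fL2 hex].
pose h := bessel s f.
(* Membership in $H^s$ ensures that [xget] does not return its default. *)
have hb : is_bessel s f h by exact: (xgetPex _ hex).
have [] := is_bessel_energy (ltW s0) hb.
set u := (fun xi => complex.Re _); set v := (fun xi => complex.Im _).
move=> mu_ mv suv HE.
have [hL2 _ _] := hb.
pose I2 := (\int[lebesgue_measure]_x (sqmod (h x))%:E)%E.
have I2E : I2 = (L2norm h `^ 2)%E by rewrite L2norm_sq.
have I20 : (0 <= I2)%E by rewrite I2E poweR_ge0.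
have I2oo : (I2 < +oo)%E by rewrite I2E poweR_lty//; case: hL2.
pose E := 8 * pi * fine I2.
have E0 : 0 <= E by rewrite /E mulr_ge0 ?fine_ge0// mulr_ge0 ?pi_ge0.
have EE : (E%:E = (8 * pi)%:E * I2)%E by rewrite EFinM fineK// ge0_fin_numE.
have su M : square_integrable lebesgue_measure `[- M, M] u by have [] := suv M.
have sv M : square_integrable lebesgue_measure `[- M, M] v by have [] := suv M.
have HE1 M : 0 <= M -> (\int[lebesgue_measure]_(xi in `[(- M)%R, M])
    (sobolev_weight s xi * (u xi ^+ 2 + v xi ^+ 2))%:E <= E%:E)%E.
  by move=> M0; rewrite EE; exact: HE.
have HE2 M : 0 <= M -> (\int[lebesgue_measure]_(xi in `[(- M)%R, M])
    (sobolev_weight s xi * (v xi ^+ 2 + (- u xi) ^+ 2))%:E <= E%:E)%E.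
  move=> M0; apply: le_trans (HE1 M M0); rewrite le_eqVlt; apply/orP; left; apply/eqP.
  by apply: eq_integral => xi _; rewrite sqrrN addrC.
have mNu : measurable_fun setT (fun xi => - u xi) by exact: measurableT_comp.
have [H1 [mH1 H10 H1E H1P]] := HC u v E E0 mu_ mv su sv HE1.
(* The pair $(v, -u)$ represents $-i \hat f$, whose real oscillatory integral is the imaginary part
   of that of $\hat f$. *)
have [H2 [mH2 H20 H2E H2P]] := HC v (fun xi => - u xi) E E0 mv mNu sv
  (fun M => square_integrableN (su M)) HE2.
have iH (H : R -> \bar R) : measurable_fun setT H -> (forall x, 0 <= H x)%E ->
    (\int[lebesgue_measure]_(x in `[(-1)%R, 1%R]) H x <= (C0 * E)%:E)%E ->
    {ae lebesgue_measure, forall x : R, x \in `[-1, 1] -> (H x < +oo)%E}.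
  move=> mH H0 HI.
  have i1 : lebesgue_measure.-integrable `[-1, 1] H.
    apply/integrableP; split; first exact: measurable_funTS.
    apply: le_lt_trans (ltry (C0 * E)); apply: le_trans HI.
    by apply: le_nonneg_integral => x _ //; rewrite gee0_abs.
  have mI : measurable (`[-1, 1]%classic : set R) by exact: measurable_itv.
  have := @integrable_ae _ _ _ lebesgue_measure `[-1, 1]%classic mI H i1.
  apply: filterS => x Hx x1; rewrite -ge0_fin_numE//; exact: Hx.
have lim x t : (H1 x < +oo)%E -> (H2 x < +oo)%E -> t \in `[-1, 1] ->
    evol_defined m t f (gamma x t) /\
    Normc.normc (evol m t f (gamma x t)) ^+ 2 <= K0 * (fine (H1 x) + fine (H2 x)).
  move=> h1 h2 ht.
  have [cA lA] := H1P x h1 t ht.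
  have [cB lB] := H2P x h2 t ht.
  set A := (fun N : nat => _) in cA lA; set B := (fun N : nat => _) in cB lB.
  have cv := complex_scaled_cvg c0 cA cB.
  have tE : evol_trunc m t f (gamma x t) = (fun n => (c%:C * (A n +i* B n))%C : R[i]^o).
    by apply/funext => N; exact: evol_truncE.
  split; first by rewrite /evol_defined tE; apply/cvg_ex; eexists; exact: cv.
  have -> : evol m t f (gamma x t) = (c%:C * (limn A +i* limn B))%C.
    by rewrite /evol tE; exact: (cvg_lim (@norm_hausdorff _ (R[i]^o)) cv).
  rewrite sqr_normcE /sqmod/= !mul0r subr0 addr0 !exprMn -mulrDr /K0 -mulrA.
  rewrite ler_wpM2l ?sqr_ge0//.
  apply: le_trans (lerD lA lB) _; rewrite -mulrDr ler_wpM2r ?addr_ge0 ?fine_ge0//.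
  by rewrite lerDl.
split.
  move: (iH _ mH1 H10 H1E) (iH _ mH2 H20 H2E);
  apply: (@filterS2 _ _ (ae_filter_ringOfSetsType _)) => x h1 h2 x1 t ht.
  by have [] := lim x t (h1 x1) (h2 x1) ht.
have main : (\int[lebesgue_measure]_(x in `[(-1)%R, 1%R])
        ereal_sup [set (Normc.normc (evol m t f (gamma x t)) ^+ 2)%:E
                  | t in `[(-1)%R, 1%R]] <= K1%:E * L2norm h `^ 2)%E.
  apply: (@le_trans _ _ (\int[lebesgue_measure]_(x in `[(-1)%R, 1%R])
    (K0%:E * (H1 x + H2 x)))%E).
    apply: le_nonneg_integral => x _.
      apply: (@le_trans _ _ (Normc.normc (evol m 0 f (gamma x 0)) ^+ 2)%:E).
        by rewrite lee_fin sqr_ge0.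
      by apply: ereal_sup_ubound; exists 0 => //=; rewrite in_itv/= lerN10 ler01.
    have [h1|h1] := ltP (H1 x) +oo%E; last first.
      move: h1; rewrite leye_eq => /eqP ->; rewrite addye; last first.
        by rewrite gt_eqF// (lt_le_trans _ (H20 x))// ltNye.
      by rewrite gt0_muley ?lte_fin// leey.
    have [h2|h2] := ltP (H2 x) +oo%E; last first.
      move: h2; rewrite leye_eq => /eqP ->; rewrite addey; last first.
        by rewrite gt_eqF// (lt_le_trans _ (H10 x))// ltNye.
      by rewrite gt0_muley ?lte_fin// leey.
    apply: ge_ereal_sup => _ [t /= ht <-].
    have [_ l] := lim x t h1 h2 ht.
    apply: (@le_trans _ _ (K0 * (fine (H1 x) + fine (H2 x)))%:E).
      by rewrite lee_fin.
    by rewrite EFinM EFinD !fineK ?ge0_fin_numE.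
  rewrite ge0_integralZl_EFin//; last 3 first.
  - by move=> x _; rewrite adde_ge0.
  - by apply: measurable_funTS; exact: emeasurable_funD.
  - exact: ltW.
  rewrite ge0_integralD//; last 2 first.
  - exact: measurable_funTS.
  - exact: measurable_funTS.
  have K1E : (K1%:E * L2norm h `^ 2 = K0%:E * (2 * (C0 * E))%:E)%E.
    rewrite -I2E /K1 (EFinM K0) -muleA; congr (_ * _)%E.
    have I2f : I2 = (fine I2)%:E by rewrite fineK// ge0_fin_numE.
    by rewrite [in LHS]I2f -EFinM; congr (_%:E); rewrite /E; ring.
  rewrite K1E lee_wpmul2l ?lee_fin ?(ltW K00)//.
  by apply: (le_trans (leeD H1E H2E)); rewrite -EFinD lee_fin mulr_natl.
have X0 : (0 <= \int[lebesgue_measure]_(x in `[(-1)%R, 1%R])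
        ereal_sup [set (Normc.normc (evol m t f (gamma x t)) ^+ 2)%:E
                  | t in `[(-1)%R, 1%R]])%E.
  apply: integral_ge0 => x _.
  apply: (@le_trans _ _ (Normc.normc (evol m 0 f (gamma x 0)) ^+ 2)%:E).
    by rewrite lee_fin sqr_ge0.
  by apply: ereal_sup_ubound; exists 0 => //=; rewrite in_itv/= lerN10 ler01.
have R0 : (0 <= K1%:E * L2norm h `^ 2)%E by exact: le_trans main.
have half0 : 0 <= 2^-1 :> R by rewrite invr_ge0.
have := gt0_ler_poweR half0 _ _ main.
rewrite !in_itv/= X0 R0 !leey => /(_ isT isT) /le_trans; apply.
rewrite poweRM ?lee_fin ?poweR_ge0// -poweRrM divff// poweRe1 ?Lnorm_ge0//.
Qed.
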